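(* Let $\mathcal{A}$ and $\mathfrak{A}$ be Banach algebras such that $\mathcal{A}$ is a Banach $\mathfrak{A}$-bimodule with compatible actions, and suppose that $\mathcal{A}/J$ and $\mathcal{A}^{**}/N$ are commutative Banach $\mathfrak{A}$-modules. If $\mathcal{A}^{**}$ is module amenable (as an $\mathfrak{A}$-module), then so is $\mathcal{A}$.
   Context: Compatible actions: $\alpha\cdot(ab)=(\alpha\cdot a)b$ and $(ab)\cdot\alpha=a(b\cdot\alpha)$ for $a,b\in\mathcal{A}$, $\alpha\in\mathfrak{A}$. An $\mathfrak{A}$-bimodule $X$ is commutative if $\alpha\cdot x=x\cdot\alpha$ for all $\alpha\in\mathfrak{A}$, $x\in X$. Dual spaces carry the dual actions $\langle\alpha\cdot\phi,x\rangle=\langle\phi,x\cdot\alpha\rangle$, $\langle a\cdot\phi,x\rangle=\langle\phi,x\cdot a\rangle$, and similarly for the right actions. The second dual $\mathcal{A}^{**}$ is a Banach algebra under the first Arens product $\square$ and a Banach $\mathfrak{A}$-bimodule with compatible actions under the second dual actions. The projective tensor product $\mathcal{A}\widehat{\bigotimes}\mathcal{A}$ is a Banach algebra with $(a\otimes b)(c\otimes d)=ac\otimes bd$. Let $I$ be the closed ideal of $\mathcal{A}\widehat{\bigotimes}\mathcal{A}$ generated by the elements $\alpha\cdot a\otimes b-a\otimes b\cdot\alpha$ ($\alpha\in\mathfrak{A}$, $a,b\in\mathcal{A}$). Let $\omega:\mathcal{A}\widehat{\bigotimes}\mathcal{A}\to\mathcal{A}$ be the bounded linear map with $\omega(a\otimes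 b)=ab$, and let $J$ be the closed ideal of $\mathcal{A}$ generated by $\omega(I)$ (that is, by the elements $\alpha\cdot(ab)-(ab)\cdot\alpha$). Likewise let $M$ be the closed ideal of $\mathcal{A}^{**}\widehat{\bigotimes}\mathcal{A}^{**}$ generated by the elements $\alpha\cdot F\otimes G-F\otimes G\cdot\alpha$ ($\alpha\in\mathfrak{A}$, $F,G\in\mathcal{A}^{**}$), and let $N$ be the closed ideal of $(\mathcal{A}^{**},\square)$ generated by the image of $M$ under the product map $F\otimes G\mapsto F\square G$. The quotients $\mathcal{A}/J$ and $\mathcal{A}^{**}/N$ carry the induced $\mathfrak{A}$-actions. For a Banach algebra $\mathcal{B}$ that is a Banach $\mathfrak{A}$-bimodule with compatible actions: a Banach $\mathcal{B}$-$\mathfrak{A}$-module is a Banach space $X$ that is a Banach $\mathcal{B}$-bimodule and a Banach $\mathfrak{A}$-bimodule with $\alpha\cdot(b\cdot x)=(\alpha\cdot b)\cdot x$, $b\cdot(\alpha\cdot x)=(b\cdot\alpha)\cdot x$, $(\alpha\cdot x)\cdot b=\alpha\cdot(x\cdot b)$, and the same for the right or two-sided actions; it is commutative if also $\alpha\cdot x=x\cdot\alpha$. A module derivation $D:\mathcal{B}\to X$ is a bounded map ($\|D(a)\|\le C\|a\|$ for some constant $C$; not assumed $\mathbb{C}$-linear) with $D(a\pm b)=D(a)\pm D(b)$, $D(ab)=D(a)\cdot b+a\cdot D(b)$, $D(\alpha\cdot a)=\alpha\cdot D(a)$, $D(a\cdot\alpha)=D(a)\cdot\alpha$. It is inner if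 for some $x\in X$, $D(a)=a\cdot x-x\cdot a$ for all $a\in\mathcal{B}$. $\mathcal{B}$ is module amenable (as an $\mathfrak{A}$-module) if for every commutative Banach $\mathcal{B}$-$\mathfrak{A}$-module $X$, every module derivation $D:\mathcal{B}\to X^*$ is inner. *)

(* Defs.v *)
From HB Require Import structures.
From mathcomp Require Import all_boot all_order all_algebra.
From mathcomp Require Import complex ring.
From mathcomp Require Import boolp classical_sets functions reals topology.
From mathcomp Require Import normedtype.

Set Implicit Arguments.
Unset Strict Implicit.
Unset Printing Implicit Defensive.

Import Order.TTheory GRing.Theory Num.Theory.
Import numFieldNormedType.Exports.

Local Open Scope classical_set_scope.
Local Open Scope ring_scope.
Local Open Scope complex_scope.

Lemma ltr0c (R : realType) (k : R) : (0 < k%:C) = (0 < k).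
Proof. exact: ltcR. Qed.

Section RealNorm.
Context {R : realType} {V : normedModType R[i]}.
Implicit Types (x y : V).

(* The library norm of a normedModType R[i] takes its values in R[i]. *)
Definition rnorm x : R := complex.Re `|x|.

Lemma rnormE x : `|x| = (rnorm x)%:C.
Proof. by rewrite /rnorm RRe_real// normr_real. Qed.

Lemma rnorm_ge0 x : 0 <= rnorm x.
Proof. by rewrite -ler0c -rnormE. Qed.

Lemma rnormD x y : rnorm (x + y) <= rnorm x + rnorm y.
Proof. by rewrite -lecR rmorphD/= -!rnormE ler_normD. Qed.

Lemma rnormN x : rnorm (- x) = rnorm x.
Proof. by rewrite /rnorm normrN. Qed.

Lemma rnormB x y : rnorm (x - y) <= rnorm x + rnorm y.
Proof. by rewrite -(rnormN y) rnormD. Qed.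

Lemma rnorm_sym x y : rnorm (x - y) = rnorm (y - x).
Proof. by rewrite /rnorm distrC. Qed.

Lemma rnorm0 : rnorm (0 : V) = 0.
Proof. by rewrite /rnorm normr0. Qed.

Lemma rnorm0_eq0 x : rnorm x = 0 -> x = 0.
Proof. by move=> x0; apply/normr0_eq0; rewrite rnormE x0. Qed.

Lemma rnorm_tri x y z : rnorm (x - z) <= rnorm (x - y) + rnorm (y - z).
Proof. by rewrite (le_trans _ (rnormD _ _))// addrA subrK. Qed.

Lemma rnormZ (a : R[i]) x : rnorm (a *: x) = complex.Re `|a| * rnorm x.
Proof.
apply: complexI; rewrite rmorphM/= -!rnormE normrZ; congr (_ * _).

Qed.

Lemma rnormZr (a : R) x : rnorm (a%:C *: x) = `|a| * rnorm x.
Proof. by rewrite rnormZ normc_def/= expr0n addr0 sqrtr_sqr. Qed.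

End RealNorm.

Section Seq.
Context {R : realType} {V : normedModType R[i]}.
Implicit Types (u : nat -> V) (l : V) (U : set V).

Definition scvg u l :=
  forall e : R, 0 < e -> exists N, forall n, (N <= n)%N -> rnorm (u n - l) < e.

Definition fast_cauchy u :=
  forall N n m, (N <= n)%N -> (N <= m)%N -> rnorm (u n - u m) <= N.+1%:R^-1.

Definition cauchy_seq u := forall e : R, 0 < e ->
  exists N, forall n m, (N <= n)%N -> (N <= m)%N -> rnorm (u n - u m) < e.

Definition seq_complete :=
  forall u, fast_cauchy u -> exists l, scvg u l.

Lemma archi (e : R) : 0 < e -> exists N, N.+1%:R^-1 < e.
Proof.
move=> e0; exists (Num.truncn e^-1).
by rewrite invf_plt ?posrE ?ltr0n// truncnS_gt.
Qed.

Lemma archi_le N n : (N <= n)%N -> n.+1%:R^-1 <= N.+1%:R^-1 :> R.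
Proof. by move=> Nn; rewrite lef_pV2 ?posrE ?ltr0n// ler_nat. Qed.

Lemma scvg_uniq u l l' : scvg u l -> scvg u l' -> l = l'.
Proof.
move=> ul ul'; apply/eqP; rewrite -subr_eq0; apply/eqP/rnorm0_eq0/eqP.
rewrite eq_le rnorm_ge0 andbT; apply/ler_addgt0Pr => e e0; rewrite add0r.
have e2 : 0 < e / 2 by rewrite divr_gt0.
have [N1 h1] := ul _ e2; have [N2 h2] := ul' _ e2.
set n := maxn N1 N2.
rewrite (le_trans (rnorm_tri _ (u n) _))// (splitr e) lerD//.
  by rewrite rnorm_sym ltW// h1 ?leq_maxl.
by rewrite ltW// h2 ?leq_maxr.
Qed.

Lemma fast_cauchy_lim u l : fast_cauchy u -> scvg u l ->
  forall N n, (N <= n)%N -> rnorm (u n - l) <= N.+1%:R^-1.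
Proof.
move=> uC ul N n Nn; apply/ler_addgt0Pr => e e0.
have [M h] := ul _ e0.
rewrite (le_trans (rnorm_tri _ (u (maxn N M)) _))// lerD//.
  by rewrite uC// leq_maxl.
by rewrite ltW// h// leq_maxr.
Qed.

Lemma nbhs_rball x (U : set V) :
  nbhs x U <-> exists2 e : R, 0 < e & forall y, rnorm (y - x) < e -> U y.
Proof.
split.
  rewrite -nbhs_ballE => -[/= e e0 xU].
  have eR : (complex.Re e)%:C = e by rewrite RRe_real// gtr0_real.
  exists (complex.Re e); first by rewrite -ltr0c eR.
  move=> y yx; apply: xU; rewrite -ball_normE/=.
  by rewrite distrC rnormE -eR ltcR.
move=> [e e0 h]; rewrite -nbhs_ballE; exists e%:C; first by rewrite /= ltr0c.
by move=> y; rewrite -ball_normE/= distrC rnormE ltcR; exact: h.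
Qed.

Lemma closed_seq U : closed U <->
  (forall l, (forall e : R, 0 < e -> exists2 y, U y & rnorm (y - l) < e) -> U l).
Proof.
split=> [Uc l h|h l lU].
  apply: Uc => B /nbhs_rball[e e0 eB].
  by have [y Uy yl] := h _ e0; exists y; split => //; exact: eB.
apply: h => e e0.
have /lU[y [Uy yl]] : nbhs l [set y | rnorm (y - l) < e].
  by apply/nbhs_rball; exists e.
by exists y.
Qed.

Lemma closed_scvg U u l : closed U -> (forall n, U (u n)) -> scvg u l -> U l.
Proof.
move=> /closed_seq Uc Uu ul; apply: Uc => e e0.
by have [N h] := ul _ e0; exists (u N) => //; exact: h.
Qed.

Lemma seq_completeP : seq_complete ->
  forall F : set_system V, ProperFilter F -> cauchy F -> cvg F.
Proof.
move=> Vc F FF /cauchyP FC.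
have ex (n : nat) : exists x, F [set y | rnorm (y - x) < n.+1%:R^-1 / 2].
  have e0 : 0 < n.+1%:R^-1 / 2 :> R by rewrite divr_gt0// invr_gt0 ltr0n.
  have e0C : 0 < (n.+1%:R^-1 / 2 : R)%:C by exact: (etrans (ltr0c _) e0).
  have [x Fx] := FC _ e0C.
  exists x; apply: filterS Fx => y; rewrite -ball_normE/=.
  by rewrite distrC rnormE ltcR.
have [u Fu] := choice ex.
have uC : fast_cauchy u.
  move=> N n m Nn Nm.
  have [y [yn ym]] := filter_ex (filterI (Fu n) (Fu m)).
  rewrite (le_trans (rnorm_tri _ y _))// (splitr N.+1%:R^-1) lerD//.
    rewrite rnorm_sym (le_trans (ltW yn))// ler_wpM2r ?invr_ge0//.
    exact: archi_le.
  rewrite (le_trans (ltW ym))// ler_wpM2r ?invr_ge0//.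
  exact: archi_le.
have [l ul] := Vc _ uC.
apply/cvg_ex; exists l => U /nbhs_rball[e e0 eU].
have e2 : 0 < e / 2 by rewrite divr_gt0.
have [N1 h1] := ul _ e2; have [N2 h2] := archi e2.
set n := maxn N1 N2.
apply: filterS (Fu n) => y/= yu; apply: eU.
rewrite (le_lt_trans (rnorm_tri _ (u n) _))// (splitr e) ltrD// ?h1 ?leq_maxl//.
rewrite (lt_trans yu)// (le_lt_trans _ h2)//.
rewrite (@le_trans _ _ n.+1%:R^-1) ?archi_le ?leq_maxr//.
by rewrite ler_pdivrMr// ler_peMr ?invr_ge0// ler1n.
Qed.

Lemma fast_cauchyW u : fast_cauchy u -> cauchy_seq u.
Proof.
move=> uC e /archi[N Ne]; exists N => n m Nn Nm.
by rewrite (le_lt_trans _ Ne)// uC.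
Qed.

End Seq.

Lemma banach_cauchy {R : realType} (V : completeNormedModType R[i])
  (u : nat -> V) : cauchy_seq u -> exists l, scvg u l.
Proof.
move=> uC.
have /cauchy_cvg : cauchy (u @ \oo).
  apply/cauchyP => e e0.
  have eR : (complex.Re e)%:C = e by rewrite RRe_real// gtr0_real.
  have /uC[N Ne] : 0 < complex.Re e by rewrite -ltr0c eR.
  exists (u N), N => // n/= Nn; rewrite -ball_normE/= rnormE -eR ltcR.
  exact: Ne.
move=> /cvg_ex[l ul]; exists l => e e0.
have /ul[N _ h] : nbhs l [set y | rnorm (y - l) < e].
  by apply/nbhs_rball; exists e.
by exists N => n Nn; exact: h.
Qed.

(* The Banach space C over itself.  An alias is needed because the library
   already fixes the completeness instance on regular modules R^o to real R. *)
Definition scalars (R : realType) : Type := (R[i])^o.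

HB.instance Definition _ (R : realType) :=
  NormedModule.copy (scalars R) (R[i])^o.

Section ScalarsComplete.
Context {R : realType}.

Lemma normc_geRe (z : R[i]) : `|complex.Re z| <= complex.Re `|z|.
Proof.
rewrite normc_def/= -sqrtr_sqr ler_wsqrtr//.
by rewrite lerDl sqr_ge0.
Qed.

Lemma normc_geIm (z : R[i]) : `|complex.Im z| <= complex.Re `|z|.
Proof.
rewrite normc_def/= -sqrtr_sqr ler_wsqrtr//.
by rewrite lerDr sqr_ge0.
Qed.

Lemma normc_leReIm (z : R[i]) :
  complex.Re `|z| <= `|complex.Re z| + `|complex.Im z|.
Proof.
rewrite normc_def/= -(@ler_pXn2r _ 2)// ?nnegrE ?sqrtr_ge0 ?addr_ge0//.
rewrite sqr_sqrtr ?addr_ge0 ?sqr_ge0// sqrrD !real_normK ?num_real//.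
by rewrite lerD2r lerDl mulrn_wge0// mulr_ge0.
Qed.

Lemma R_seq_complete (x : nat -> R) :
  (forall N n m, (N <= n)%N -> (N <= m)%N -> `|x n - x m| <= N.+1%:R^-1) ->
  exists l, forall e, 0 < e -> exists N, forall n, (N <= n)%N -> `|x n - l| < e.
Proof.
move=> xC.
have /R_complete : cauchy (x @ \oo).
  apply/cauchyP => e /archi[N Ne].
  exists (x N), N => // n/= Nn; rewrite -ball_normE/=.
  by rewrite (le_lt_trans _ Ne)// xC.
move=> /cvg_ex[l xl]; exists l => e e0.
have /xl[N _ h] : nbhs l [set y | `|y - l| < e].
  by exists e => // y; rewrite /= distrC.
by exists N => n Nn; exact: h.
Qed.

Lemma scalars_seq_complete : @seq_complete R (scalars R).
Proof.
move=> u uC.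
have [|a ha] := @R_seq_complete (fun n => complex.Re (u n : R[i])).
  move=> N n m Nn Nm; rewrite -raddfB (le_trans (normc_geRe _))//.
  exact: uC.
have [|b hb] := @R_seq_complete (fun n => complex.Im (u n : R[i])).
  move=> N n m Nn Nm; rewrite -raddfB (le_trans (normc_geIm _))//.
  exact: uC.
exists (a +i* b) => e e0.
have e2 : 0 < e / 2 by rewrite divr_gt0.
have [N1 h1] := ha _ e2; have [N2 h2] := hb _ e2.
exists (maxn N1 N2) => n; rewrite geq_max => /andP[n1 n2].
rewrite (le_lt_trans (normc_leReIm _))// (splitr e).
have -> : (u n - (a +i* b)) = (u n : R[i]) - (a +i* b) by [].
by rewrite !raddfB/= ltrD// ?h1 ?h2.
Qed.

End ScalarsComplete.

HB.instance Definition _ (R : realType) := Uniform_isComplete.Build (scalars R)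
  (seq_completeP (@scalars_seq_complete R)).


Lemma normM_leE {R : realType} {V W : normedModType R[i]} (M : R)
    (x : V) (y : W) :
  (`|y| <= M%:C * `|x|) = (rnorm y <= M * rnorm x).
Proof. by rewrite !rnormE -rmorphM lecR. Qed.

Section BoundedLinear.
Context {R : realType}.
Implicit Types X Y Z : completeNormedModType R[i].

Record bounded_linear X Y := BoundedLinear {
  blin_fun :> X -> Y;
  blin_linear : linear blin_fun;
  blin_bounded : exists M : R, forall x, `|blin_fun x| <= M%:C * `|x| }.

Lemma blin_ext X Y (f g : bounded_linear X Y) : f =1 g -> f = g.
Proof.
case: f g => [f fl fb] [g gl gb] /= /funext fg; case: _ / fg gl gb => gl gb.
by rewrite (Prop_irrelevance fl gl) (Prop_irrelevance fb gb).
Qed.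

Lemma blin_rbounded X Y (f : bounded_linear X Y) :
  exists2 M : R, 0 <= M & forall x, rnorm (f x) <= M * rnorm x.
Proof.
have [M fM] := blin_bounded f; exists `|M| => // x.
have := fM x; rewrite normM_leE// => /le_trans; apply.
by rewrite ler_wpM2r ?rnorm_ge0// ler_norm.
Qed.

Lemma mk_rbounded X Y (f : X -> Y) :
  (exists M : R, forall x, rnorm (f x) <= M * rnorm x) ->
  exists M : R, forall x, `|f x| <= M%:C * `|x|.
Proof. by move=> [M fM]; exists M => x; rewrite normM_leE. Qed.

Section Algebra.
Variables X Y : completeNormedModType R[i].
Local Notation H := (bounded_linear X Y).
Implicit Types f g : H.

HB.instance Definition _ := gen_eqMixin H.
HB.instance Definition _ := gen_choiceMixin H.

Lemma blinD f x y : f (x + y) = f x + f y.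
Proof. by have := blin_linear f 1 x y; rewrite !scale1r. Qed.

Lemma blin0 f : f 0 = 0.
Proof. by apply: (addrI (f 0)); rewrite -blinD !addr0. Qed.

Lemma blinZ f (a : R[i]) x : f (a *: x) = a *: f x.
Proof. by have := blin_linear f a x 0; rewrite !addr0 blin0 addr0. Qed.

Lemma blinN f x : f (- x) = - f x.
Proof. by rewrite -scaleN1r blinZ scaleN1r. Qed.

Lemma blinB f x y : f (x - y) = f x - f y.
Proof. by rewrite blinD blinN. Qed.

Program Definition blin_zero : H := @BoundedLinear X Y (fun=> 0) _ _.
Next Obligation. by move=> a x y /=; rewrite scaler0 addr0. Qed.
Next Obligation.
by apply: mk_rbounded; exists 0 => x; rewrite rnorm0 mul0r.
Qed.

Program Definition blin_add f g : H :=
  @BoundedLinear X Y (fun x => f x + g x) _ _.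
Next Obligation.
by move=> f g a x y /=; rewrite !blinD !blinZ scalerDr addrACA.
Qed.
Next Obligation.
move=> f g; apply: mk_rbounded.
have [M M0 fM] := blin_rbounded f; have [N N0 gN] := blin_rbounded g.
exists (M + N) => x; rewrite mulrDl (le_trans (rnormD _ _))//.
by rewrite lerD.
Qed.

Program Definition blin_scale (c : R[i]) f : H :=
  @BoundedLinear X Y (fun x => c *: f x) _ _.
Next Obligation.
move=> c f a x y /=; rewrite blinD blinZ scalerDr !scalerA.
by rewrite mulrC.
Qed.
Next Obligation.
move=> c f; apply: mk_rbounded.
have [M M0 fM] := blin_rbounded f.
exists (complex.Re `|c| * M) => x; rewrite rnormZ -mulrA ler_wpM2l//.
by rewrite -ler0c RRe_real ?normr_real.
Qed.

Definition blin_opp f : H := blin_scale (-1) f.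

Lemma blin_addA : associative blin_add.
Proof. by move=> f g h; apply: blin_ext => x /=; rewrite addrA. Qed.
Lemma blin_addC : commutative blin_add.
Proof. by move=> f g; apply: blin_ext => x /=; rewrite addrC. Qed.
Lemma blin_add0 : left_id blin_zero blin_add.
Proof. by move=> f; apply: blin_ext => x /=; rewrite add0r. Qed.
Lemma blin_addN : left_inverse blin_zero blin_opp blin_add.
Proof. by move=> f; apply: blin_ext => x /=; rewrite scaleN1r addNr. Qed.

HB.instance Definition _ := GRing.isZmodule.Build H
  blin_addA blin_addC blin_add0 blin_addN.

Lemma blin_scaleA (a b : R[i]) f :
  blin_scale a (blin_scale b f) = blin_scale (a * b) f.
Proof. by apply: blin_ext => x /=; rewrite scalerA. Qed.
Lemma blin_scale1 : left_id 1 blin_scale.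
Proof. by move=> f; apply: blin_ext => x /=; rewrite scale1r. Qed.
Lemma blin_scaleDr : right_distributive blin_scale +%R.
Proof. by move=> a f g; apply: blin_ext => x /=; rewrite scalerDr. Qed.
Lemma blin_scaleDl f : {morph blin_scale^~ f : a b / a + b}.
Proof. by move=> a b; apply: blin_ext => x /=; rewrite scalerDl. Qed.

HB.instance Definition _ := GRing.Zmodule_isLmodule.Build R[i] H
  blin_scaleA blin_scale1 blin_scaleDr blin_scaleDl.

Lemma blin_addE f g x : (f + g) x = f x + g x. Proof. by []. Qed.
Lemma blin_oppE f x : (- f) x = - f x. Proof. exact: scaleN1r. Qed.
Lemma blin_subE f g x : (f - g) x = f x - g x.
Proof. by rewrite blin_addE blin_oppE. Qed.
Lemma blin_scaleE (a : R[i]) f x : (a *: f) x = a *: f x. Proof. by []. Qed.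
Lemma blin_zeroE x : (0 : H) x = 0. Proof. by []. Qed.

Definition opnorm f : R := sup [set rnorm (f x) | x in [set x | rnorm x <= 1]].

Lemma opnorm_has_sup f : has_sup [set rnorm (f x) | x in [set x | rnorm x <= 1]].
Proof.
split; first by exists (rnorm (f 0)), 0; rewrite //= rnorm0.
have [M M0 fM] := blin_rbounded f; exists M => _ [x /= x1 <-].
by rewrite (le_trans (fM x))// -[leRHS]mulr1 ler_wpM2l.
Qed.

Lemma opnorm_ge0 f : 0 <= opnorm f.
Proof.
have := sup_upper_bound (opnorm_has_sup f).
move=> /(_ (rnorm (f 0))) h; apply: le_trans (h _); first exact: rnorm_ge0.
by exists 0; rewrite //= rnorm0.
Qed.

Lemma opnormP f x : rnorm (f x) <= opnorm f * rnorm x.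
Proof.
have [x0|x0] := eqVneq (rnorm x) 0.
  by rewrite (rnorm0_eq0 x0) blin0 !rnorm0 mulr0.
have xp : 0 < rnorm x by rewrite lt_def x0 rnorm_ge0.
rewrite -ler_pdivrMr//.
have -> : rnorm (f x) / rnorm x = rnorm (f ((rnorm x)^-1%:C *: x)).
  by rewrite blinZ rnormZr ger0_norm ?invr_ge0 ?rnorm_ge0// mulrC.
apply: sup_upper_bound; first exact: opnorm_has_sup.
exists ((rnorm x)^-1%:C *: x) => //=.
by rewrite rnormZr ger0_norm ?invr_ge0 ?rnorm_ge0// mulVf.
Qed.

Lemma opnorm_le f M : 0 <= M -> (forall x, rnorm (f x) <= M * rnorm x) ->
  opnorm f <= M.
Proof.
move=> M0 fM; apply: ge_sup; first exact: (opnorm_has_sup f).1.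
move=> _ [x /= x1 <-]; rewrite (le_trans (fM x))//.
by rewrite -[leRHS]mulr1 ler_wpM2l.
Qed.

Let norm f : R[i] := (opnorm f)%:C.

Lemma blin_ler_normD f g : norm (f + g) <= norm f + norm g.
Proof.
rewrite /norm -rmorphD lecR; apply: opnorm_le.
  by rewrite addr_ge0 ?opnorm_ge0.
move=> x; rewrite mulrDl (le_trans (rnormD _ _))//.
by rewrite lerD ?opnormP.
Qed.

Lemma blin_normZ (a : R[i]) f : norm (a *: f) = `|a| * norm f.
Proof.
have aE : `|a| = (complex.Re `|a|)%:C by rewrite RRe_real// normr_real.
have a0 : 0 <= complex.Re `|a| by rewrite -ler0c -aE.
rewrite /norm aE -rmorphM; congr (_ %:C)%C; apply/eqP; rewrite eq_le.
apply/andP; split.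
  apply: opnorm_le; first by rewrite mulr_ge0 ?opnorm_ge0.
  by move=> x; rewrite rnormZ -mulrA ler_wpM2l ?opnormP.
have [a00|a00] := eqVneq (complex.Re `|a|) 0; first by rewrite a00 mul0r opnorm_ge0.
have ap : 0 < complex.Re `|a| by rewrite lt_def a00.
rewrite mulrC -ler_pdivlMr//; apply: opnorm_le.
  by rewrite divr_ge0 ?opnorm_ge0.
move=> x; rewrite mulrAC ler_pdivlMr// mulrC -rnormZ.
exact: (opnormP (a *: f)).
Qed.

Lemma blin_norm0_eq0 f : norm f = 0 -> f = 0.
Proof.
move=> /complexI f0; apply: blin_ext => x; apply: rnorm0_eq0; apply/eqP.
by rewrite eq_le rnorm_ge0 andbT (le_trans (opnormP f x))// f0 mul0r.
Qed.

HB.instance Definition _ := Lmodule_isNormed.Build R[i] H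
  blin_ler_normD blin_normZ blin_norm0_eq0.

Lemma blin_normE f : rnorm f = opnorm f.
Proof. by []. Qed.

Lemma blin_normP f x : rnorm (f x) <= rnorm f * rnorm x.
Proof. exact: opnormP. Qed.

Lemma blin_norm_le f M : 0 <= M -> (forall x, rnorm (f x) <= M * rnorm x) ->
  rnorm f <= M.
Proof. exact: opnorm_le. Qed.

Lemma scvg_add (V : normedModType R[i]) (u v : nat -> V) l l' :
  scvg u l -> scvg v l' -> scvg (fun n => u n + v n) (l + l').
Proof.
move=> ul vl e e0; have e2 : 0 < e / 2 by rewrite divr_gt0.
have [N1 h1] := ul _ e2; have [N2 h2] := vl _ e2.
exists (maxn N1 N2) => n; rewrite geq_max => /andP[n1 n2].
rewrite opprD addrACA (le_lt_trans (rnormD _ _))// (splitr e).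
by rewrite ltrD ?h1 ?h2.
Qed.

Lemma scvg_scale (V : normedModType R[i]) (c : R[i]) (u : nat -> V) l :
  scvg u l -> scvg (fun n => c *: u n) (c *: l).
Proof.
have c0 : 0 <= complex.Re `|c| by rewrite -ler0c RRe_real ?normr_real.
move=> ul e e0; have ec : 0 < e / (complex.Re `|c| + 1).
  by rewrite divr_gt0// ltr_wpDl.
have [N h] := ul _ ec; exists N => n Nn.
rewrite -scalerBr rnormZ (@le_lt_trans _ _ ((complex.Re `|c| + 1) * rnorm (u n - l)))//.
  by rewrite ler_wpM2r ?rnorm_ge0// lerDl.
by rewrite mulrC -ltr_pdivlMr ?h// ltr_wpDl.
Qed.

Lemma blin_seq_complete : @seq_complete R H.
Proof.
move=> u uC.
have ux x : exists l, scvg (fun n => u n x) l.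
  apply: banach_cauchy => e e0.
  have /(fast_cauchyW uC)[N h] : 0 < e / (rnorm x + 1).
    by rewrite divr_gt0// ltr_wpDl ?rnorm_ge0.
  exists N => n m Nn Nm; rewrite -blin_subE.
  rewrite (le_lt_trans (blin_normP _ _))//.
  rewrite (@le_lt_trans _ _ (rnorm (u n - u m) * (rnorm x + 1)))//.
    by rewrite ler_wpM2l ?rnorm_ge0// lerDl.
  by rewrite -ltr_pdivlMr ?h// ltr_wpDl ?rnorm_ge0.
have [l ul] := choice ux.
have llin : linear l.
  move=> a x y; apply: scvg_uniq (ul _) _.
  have := scvg_add (scvg_scale a (ul x)) (ul y).
  by congr scvg; apply/funext => n; rewrite blinD blinZ.
have lb N n x : (N <= n)%N -> rnorm (u n x - l x) <= N.+1%:R^-1 * rnorm x.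
  move=> Nn; apply/ler_addgt0Pr => e e0; have [M h] := ul x _ e0.
  rewrite (le_trans (rnorm_tri _ (u (maxn N M) x) _))// lerD//.
    rewrite -blin_subE (le_trans (blin_normP _ _))// ler_wpM2r ?rnorm_ge0//.
    by rewrite uC// leq_maxl.
  by rewrite ltW// h// leq_maxr.
have lbnd : exists M : R, forall x, rnorm (l x) <= M * rnorm x.
  exists (rnorm (u 0%N) + 1) => x.
  have -> : l x = u 0%N x - (u 0%N x - l x) by rewrite opprB addrC subrK.
  rewrite (le_trans (rnormB _ _))// mulrDl lerD ?blin_normP//.
  by have := lb 0%N 0%N x (leqnn _); rewrite invr1.
pose L : H := BoundedLinear llin (mk_rbounded lbnd).
exists L => e /archi[N Ne]; exists N => n Nn.
rewrite (le_lt_trans _ Ne)//; apply: blin_norm_le; first by rewrite invr_ge0.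
by move=> x; rewrite blin_subE/= lb.
Qed.

HB.instance Definition _ := Uniform_isComplete.Build H
  (seq_completeP blin_seq_complete).

End Algebra.
End BoundedLinear.

Notation "''L' ( X , Y )" := (bounded_linear X Y) : type_scope.

Section ClosedSubspace.
Context {R : realType}.
Implicit Types X Y : completeNormedModType R[i].

Definition is_closed_subspace X (U : set X) : Prop :=
  [/\ closed U, U 0, forall x y, U x -> U y -> U (x + y) &
      forall (c : R[i]) x, U x -> U (c *: x)].

Record closed_subspace X := ClosedSubspace {
  cs_set :> X -> Prop;
  cs_axiom : is_closed_subspace cs_set }.

Lemma closed_subspace_smallest X (C : set X -> Prop) (S : set X) :
  (forall U, C U -> is_closed_subspace U) -> is_closed_subspace (smallest C S).
Proof.
move=> CU; split.
- by apply: closed_bigI => U [/CU[]].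
- by move=> U [/CU[]].
- move=> x y Sx Sy U CSU; case: (CU _ CSU.1) => _ _ UD _.
  by apply: UD; [exact: Sx|exact: Sy].
- by move=> c x Sx U CSU; case: (CU _ CSU.1) => _ _ _; apply; exact: Sx.
Qed.

Definition closed_span X (S : set X) : closed_subspace X :=
  ClosedSubspace (closed_subspace_smallest S (fun U (h : is_closed_subspace U) => h)).

Section Theory.
Variables (X : completeNormedModType R[i]) (U : closed_subspace X).

Lemma cs_closed : closed (cs_set U). Proof. by case: (cs_axiom U). Qed.
Lemma cs0 : U 0. Proof. by case: (cs_axiom U). Qed.
Lemma csD x y : U x -> U y -> U (x + y).
Proof. by case: (cs_axiom U) => _ _ + _; apply. Qed.
Lemma csZ (c : R[i]) x : U x -> U (c *: x).
Proof. by case: (cs_axiom U) => _ _ _; apply. Qed.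
Lemma csN x : U x -> U (- x).
Proof. by rewrite -scaleN1r; exact: csZ. Qed.
Lemma csB x y : U x -> U y -> U (x - y).
Proof. by move=> Ux Uy; apply: csD => //; exact: csN. Qed.

Record subspace_of := SubspaceOf { sub_val :> X; sub_valP : U sub_val }.
Local Notation T := subspace_of.
Implicit Types u v : T.

Lemma sub_ext u v : u = v :> X -> u = v.
Proof.
case: u v => [u Uu] [v Uv] /= uv; case: _ / uv Uv => Uv.
by rewrite (Prop_irrelevance Uu Uv).
Qed.

HB.instance Definition _ := gen_eqMixin T.
HB.instance Definition _ := gen_choiceMixin T.

Definition sub_zero : T := SubspaceOf cs0.
Definition sub_add u v : T := SubspaceOf (csD (sub_valP u) (sub_valP v)).
Definition sub_scale (c : R[i]) u : T := SubspaceOf (csZ c (sub_valP u)).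
Definition sub_opp u : T := sub_scale (-1) u.

Lemma sub_addA : associative sub_add.
Proof. by move=> f g h; apply: sub_ext => /=; rewrite addrA. Qed.
Lemma sub_addC : commutative sub_add.
Proof. by move=> f g; apply: sub_ext => /=; rewrite addrC. Qed.
Lemma sub_add0 : left_id sub_zero sub_add.
Proof. by move=> f; apply: sub_ext => /=; rewrite add0r. Qed.
Lemma sub_addN : left_inverse sub_zero sub_opp sub_add.
Proof. by move=> f; apply: sub_ext => /=; rewrite scaleN1r addNr. Qed.

HB.instance Definition _ := GRing.isZmodule.Build T
  sub_addA sub_addC sub_add0 sub_addN.

Lemma sub_scaleA (a b : R[i]) u :
  sub_scale a (sub_scale b u) = sub_scale (a * b) u.
Proof. by apply: sub_ext => /=; rewrite scalerA. Qed.
Lemma sub_scale1 : left_id 1 sub_scale.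
Proof. by move=> f; apply: sub_ext => /=; rewrite scale1r. Qed.
Lemma sub_scaleDr : right_distributive sub_scale +%R.
Proof. by move=> a f g; apply: sub_ext => /=; rewrite scalerDr. Qed.
Lemma sub_scaleDl u : {morph sub_scale^~ u : a b / a + b}.
Proof. by move=> a b; apply: sub_ext => /=; rewrite scalerDl. Qed.

HB.instance Definition _ := GRing.Zmodule_isLmodule.Build R[i] T
  sub_scaleA sub_scale1 sub_scaleDr sub_scaleDl.

Let norm u : R[i] := `|sub_val u|.

Lemma sub_ler_normD u v : norm (u + v) <= norm u + norm v.
Proof. exact: ler_normD. Qed.

Lemma sub_normZ (a : R[i]) u : norm (a *: u) = `|a| * norm u.
Proof. exact: normrZ. Qed.

Lemma sub_norm0_eq0 u : norm u = 0 -> u = 0.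
Proof. by move=> u0; apply: sub_ext; apply: (normr0_eq0 u0). Qed.

HB.instance Definition _ := Lmodule_isNormed.Build R[i] T
  sub_ler_normD sub_normZ sub_norm0_eq0.

Lemma sub_valD u v : sub_val (u + v) = sub_val u + sub_val v.
Proof. by []. Qed.
Lemma sub_valZ (c : R[i]) u : sub_val (c *: u) = c *: sub_val u.
Proof. by []. Qed.
Lemma sub_valB u v : sub_val (u - v) = sub_val u - sub_val v.
Proof. by rewrite sub_valD; congr (_ + _); exact: scaleN1r. Qed.
Lemma sub_normE u : rnorm u = rnorm (sub_val u). Proof. by []. Qed.

Lemma sub_seq_complete : @seq_complete R T.
Proof.
move=> u uC; have [|l ul] := @banach_cauchy R X (fun n => sub_val (u n)).
  move=> e e0; have [N h] := fast_cauchyW uC e0; exists N => n m Nn Nm.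
  by rewrite -sub_valB; exact: h.
have Ul : U l by apply: (closed_scvg cs_closed _ ul) => n; exact: sub_valP.
exists (SubspaceOf Ul) => e /ul[N h]; exists N => n Nn.
by rewrite sub_normE sub_valB h.
Qed.

HB.instance Definition _ := Uniform_isComplete.Build T
  (seq_completeP sub_seq_complete).

Lemma sub_val_linear : linear sub_val. Proof. by []. Qed.
Lemma sub_val_bounded : exists M : R, forall u, `|sub_val u| <= M%:C * `|u|.
Proof. by exists 1 => u; rewrite rmorph1 mul1r. Qed.
Definition sub_incl : 'L(T, X) := BoundedLinear sub_val_linear sub_val_bounded.

(* The elements of the quotient Banach space are the cosets x + U. *)
Definition coset (x : X) : set X := [set y | U (y - x)].

Record quotient_by := QuotientBy {
  quot_set :> X -> Prop;
  quot_setP : exists x, quot_set = coset x }.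
Local Notation Q := quotient_by.
Implicit Types p q : Q.

Definition quot_pi (x : X) : Q := QuotientBy (ex_intro _ x erefl).
Local Notation pi := quot_pi.

Lemma quot_ext p q : quot_set p = quot_set q -> p = q.
Proof.
case: p q => [p hp] [q hq] /= pq; case: _ / pq hq => hq.
by rewrite (Prop_irrelevance hp hq).
Qed.

Lemma quot_piP x y : pi x = pi y <-> U (x - y).
Proof.
split=> [[]/seteqP[h _]|Uxy].
  by apply: (h x); rewrite /coset/= subrr; exact: cs0.
apply: quot_ext => /=; apply/seteqP; split=> z /=; rewrite /coset/= => Uz.
  by rewrite -(subrK x z) -addrA; apply: csD.
by rewrite -(subrK y z) -addrA; apply: csD => //; rewrite -opprB; exact: csN.
Qed.

Lemma quot_memP q x : q x <-> q = pi x.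
Proof.
case: (quot_setP q) => y qy; split=> [qx|->/=]; last first.
  by rewrite /coset/= subrr; exact: cs0.
have -> : q = pi y by exact: quot_ext.
by apply/quot_piP; rewrite -opprB; apply: csN; move: qx; rewrite qy.
Qed.

Definition quot_repr q : X := projT1 (cid (quot_setP q)).

Lemma quot_reprK q : pi (quot_repr q) = q.
Proof. by apply: quot_ext; rewrite /quot_repr; case: cid. Qed.

HB.instance Definition _ := gen_eqMixin Q.
HB.instance Definition _ := gen_choiceMixin Q.

Definition quot_add p q : Q := pi (quot_repr p + quot_repr q).
Definition quot_scale (c : R[i]) q : Q := pi (c *: quot_repr q).
Definition quot_opp q : Q := quot_scale (-1) q.

Lemma quot_addE x y : quot_add (pi x) (pi y) = pi (x + y).
Proof.
apply/quot_piP; rewrite opprD addrACA; apply: csD;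
by apply/quot_piP; rewrite quot_reprK.
Qed.

Lemma quot_scaleE (c : R[i]) x : quot_scale c (pi x) = pi (c *: x).
Proof.
by apply/quot_piP; rewrite -scalerBr; apply/csZ/quot_piP; rewrite quot_reprK.
Qed.

Lemma quot_addA : associative quot_add.
Proof.
move=> p q r; rewrite -(quot_reprK p) -(quot_reprK q) -(quot_reprK r).
by rewrite !quot_addE addrA.
Qed.
Lemma quot_addC : commutative quot_add.
Proof.
by move=> p q; rewrite -(quot_reprK p) -(quot_reprK q) !quot_addE addrC.
Qed.
Lemma quot_add0 : left_id (pi 0) quot_add.
Proof. by move=> p; rewrite -(quot_reprK p) quot_addE add0r. Qed.
Lemma quot_addN : left_inverse (pi 0) quot_opp quot_add.
Proof.
move=> p; rewrite -(quot_reprK p) /quot_opp quot_scaleE quot_addE.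
by rewrite scaleN1r addNr.
Qed.

HB.instance Definition _ := GRing.isZmodule.Build Q
  quot_addA quot_addC quot_add0 quot_addN.

Lemma quot_scaleA (a b : R[i]) q :
  quot_scale a (quot_scale b q) = quot_scale (a * b) q.
Proof. by rewrite -(quot_reprK q) !quot_scaleE scalerA. Qed.
Lemma quot_scale1 : left_id 1 quot_scale.
Proof. by move=> q; rewrite -(quot_reprK q) !quot_scaleE scale1r. Qed.
Lemma quot_scaleDr : right_distributive quot_scale +%R.
Proof.
move=> a p q; rewrite -(quot_reprK p) -(quot_reprK q).
rewrite [X in quot_scale a X]quot_addE !quot_scaleE scalerDr.
by rewrite [RHS]quot_addE.
Qed.
Lemma quot_scaleDl q : {morph quot_scale^~ q : a b / a + b}.
Proof.
move=> a b; rewrite /= -(quot_reprK q) !quot_scaleE scalerDl.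
by rewrite [RHS]quot_addE.
Qed.

HB.instance Definition _ := GRing.Zmodule_isLmodule.Build R[i] Q
  quot_scaleA quot_scale1 quot_scaleDr quot_scaleDl.

Lemma quot_piD x y : pi (x + y) = pi x + pi y.
Proof. by rewrite [RHS]quot_addE. Qed.
Lemma quot_piZ (c : R[i]) x : pi (c *: x) = c *: pi x.
Proof. by rewrite [RHS]quot_scaleE. Qed.
Lemma quot_piB x y : pi (x - y) = pi x - pi y.
Proof. by rewrite quot_piD -scaleN1r quot_piZ scaleN1r. Qed.
Lemma quot_pi0 : pi 0 = 0. Proof. by []. Qed.

Definition quot_norm q : R := inf [set rnorm x | x in quot_set q].

Lemma quot_has_inf q : has_inf [set rnorm x | x in quot_set q].
Proof.
split.
  exists (rnorm (quot_repr q)), (quot_repr q) => //.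
  by apply/quot_memP; rewrite quot_reprK.
by exists 0 => _ [x _ <-]; exact: rnorm_ge0.
Qed.

Lemma quot_norm_ge0 q : 0 <= quot_norm q.
Proof.
apply: lb_le_inf; first exact: (quot_has_inf q).1.
by move=> _ [x _ <-]; exact: rnorm_ge0.
Qed.

Lemma quot_norm_pi x : quot_norm (pi x) <= rnorm x.
Proof.
apply: inf_lbound; first exact: (quot_has_inf _).2.
by exists x => //; apply/quot_memP.
Qed.

Lemma quot_norm_lt q e : quot_norm q < e -> exists2 x, pi x = q & rnorm x < e.
Proof.
move=> qe; have eq0 : 0 < e - quot_norm q by rewrite subr_gt0.
have [_ [x qx <-]] := inf_adherent eq0 (quot_has_inf q).
rewrite -/(quot_norm q) addrC subrK => xe; exists x => //.
by apply/esym/quot_memP.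
Qed.

Let qn q : R[i] := (quot_norm q)%:C.

Lemma quot_ler_normD p q : qn (p + q) <= qn p + qn q.
Proof.
rewrite /qn -rmorphD lecR; apply/ler_addgt0Pr => e e0.
have e2 : 0 < e / 2 by rewrite divr_gt0.
have [|x <- xp] := @quot_norm_lt p (quot_norm p + e / 2); first by rewrite ltrDl.
have [|y <- yq] := @quot_norm_lt q (quot_norm q + e / 2); first by rewrite ltrDl.
rewrite -quot_piD (le_trans (quot_norm_pi _))// (le_trans (rnormD _ _))//.
apply: le_trans (lerD (ltW xp) (ltW yq)) _.
by rewrite addrACA -splitr.
Qed.

Lemma quot_normZ (a : R[i]) q : qn (a *: q) = `|a| * qn q.
Proof.
have aE (c : R[i]) : `|c| = (complex.Re `|c|)%:C by rewrite RRe_real// normr_real.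
have a0 (c : R[i]) : 0 <= complex.Re `|c| by rewrite -ler0c -aE.
have le (c : R[i]) p : quot_norm (c *: p) <= complex.Re `|c| * quot_norm p.
  apply/ler_addgt0Pr => e e0.
  have ec : 0 < e / (complex.Re `|c| + 1) by rewrite divr_gt0// ltr_wpDl.
  have [|x <- xp] := @quot_norm_lt p (quot_norm p + e / (complex.Re `|c| + 1)).
    by rewrite ltrDl.
  rewrite -quot_piZ (le_trans (quot_norm_pi _))// rnormZ.
  rewrite (le_trans (ler_wpM2l _ (ltW xp)))// mulrDr lerD2l mulrCA.
  by rewrite ler_piMr ?(ltW e0)// ler_pdivrMr ?ltr_wpDl// mul1r lerDl.
rewrite /qn aE -rmorphM; congr (_ %:C)%C; apply/eqP; rewrite eq_le le andTb.
have [->|an0] := eqVneq a 0.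
  rewrite (_ : complex.Re _ = 0) ?mul0r ?quot_norm_ge0//.
  exact: (congr1 (@complex.Re R) (normr0 R[i])).
have ap : 0 < complex.Re `|a| by rewrite -ltr0c -aE normr_gt0.
rewrite -ler_pdivlMl//; have := le a^-1 (a *: q).
rewrite scalerA mulVf// scale1r => /le_trans; apply.
rewrite ler_wpM2r ?quot_norm_ge0// -lecR -aE normfV aE.
by rewrite -(fmorphV (real_complex R)).
Qed.

Lemma quot_norm0_eq0 q : qn q = 0 -> q = 0.
Proof.
move=> /complexI q0; rewrite -(quot_reprK q) -quot_pi0; apply/quot_piP.
rewrite subr0; apply: (closed_seq _).1 => [|e e0]; first exact: cs_closed.
have [x xq xe] := @quot_norm_lt q e (eq_ind_r (fun z => z < e) e0 q0).
exists (quot_repr q - x); first by apply/quot_piP; rewrite quot_reprK xq.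
by rewrite addrAC subrr sub0r rnormN.
Qed.

HB.instance Definition _ := Lmodule_isNormed.Build R[i] Q
  quot_ler_normD quot_normZ quot_norm0_eq0.

Lemma quot_normE q : rnorm q = quot_norm q. Proof. by []. Qed.

Lemma quot_seq_complete : @seq_complete R Q.
Proof.
move=> u uC.
pose h (n : nat) : R := 2%:R^-1 ^+ n.
have h0 n : 0 < h n by rewrite exprn_gt0// invr_gt0.
have hS n : h n = h n.+1 + h n.+1.
  by rewrite /h exprS -mulrDl [_ + _](_ : _ = 1) ?mul1r// [RHS]splitr mul1r.
have hE n : h n = (2 ^ n)%:R^-1 by rewrite /h natrX exprVn.
pose v n := u (2 ^ n.+1)%N.
have vd n : exists d, pi d = v n.+1 - v n /\ rnorm d < h n.+1.
  have [|d dv dh] := @quot_norm_lt (v n.+1 - v n) (h n.+1); last by exists d.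
  have : rnorm (v n.+1 - v n) <= (2 ^ n.+1).+1%:R^-1.
    by apply: uC => //; rewrite leq_exp2l.
  move=> /le_lt_trans; apply.
  by rewrite hE ltf_pV2 ?posrE ?ltr0n ?expn_gt0// ltr_nat.
have [d dP] := choice vd.
pose w n := quot_repr (v 0%N) + \sum_(i < n) d i.
have wS n : w n.+1 = w n + d n by rewrite /w big_ord_recr/= addrA.
have wv n : pi (w n) = v n.
  elim: n => [|n IH]; first by rewrite /w big_ord0 addr0 quot_reprK.
  by rewrite wS quot_piD IH (dP n).1 addrC subrK.
have wd N k : rnorm (w (N + k)%N - w N) <= h N - h (N + k)%N.
  elim: k => [|k IH]; first by rewrite addn0 !subrr rnorm0.
  rewrite addnS wS addrAC (le_trans (rnormD _ _))//.
  apply: le_trans (lerD IH (ltW (dP _).2)) _.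
  by rewrite [in X in X <= _](hS (N + k)%N) opprD addrA addrNK.
have wN N n : (N <= n)%N -> rnorm (w n - w N) <= h N.
  move=> /subnKC <-; rewrite (le_trans (wd _ _))// gerBl.
  exact: ltW.
have hlt e : 0 < e -> exists N, forall n, (N <= n)%N -> h n < e.
  move=> /archi[N Ne]; exists N => n Nn; rewrite (le_lt_trans _ Ne)// hE.
  rewrite lef_pV2 ?posrE ?ltr0n ?expn_gt0// ler_nat.
  by rewrite (leq_ltn_trans Nn)// ltn_expl.
have [|l wl] := @banach_cauchy R X w.
  move=> e e0; have [|N hN] := hlt (e / 2); first by rewrite divr_gt0.
  exists N => n m Nn Nm; rewrite (le_lt_trans (rnorm_tri _ (w N) _))//.
  rewrite (splitr e) ltrD//; first by rewrite (le_lt_trans (wN _ _ Nn))// hN.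
  by rewrite rnorm_sym (le_lt_trans (wN _ _ Nm))// hN.
exists (pi l) => e e0; have e2 : 0 < e / 2 by rewrite divr_gt0.
have [N1 h1] := fast_cauchyW uC e2; have [N2 h2] := wl _ e2.
exists N1 => n N1n; pose k := maxn N1 N2.
rewrite (le_lt_trans (rnorm_tri _ (v k) _))// (splitr e) ltrD//.
  apply: h1 => //; apply: leq_trans (leq_maxl N1 N2) _.
  by rewrite -/k ltnW// (leq_ltn_trans (leqnSn _))// ltn_expl.
rewrite -wv -quot_piB (le_lt_trans (quot_norm_pi _))// h2//.
exact: leq_maxr.
Qed.

HB.instance Definition _ := Uniform_isComplete.Build Q
  (seq_completeP quot_seq_complete).

End Theory.
End ClosedSubspace.

Definition dual {R : realType} (X : completeNormedModType R[i]) :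
  completeNormedModType R[i] := 'L(X, scalars R).

Section HahnBanach.
Context {R : realType}.
Variable X : completeNormedModType R[i].
Implicit Types (G : set (X * R)) (x y v : X).

Let is_graph (x0 : X) G : Prop :=
  [/\ forall x y r s, G (x, r) -> G (y, s) -> G (x + y, r + s),
      forall (t : R) x r, G (x, r) -> G (t%:C *: x, t * r),
      forall x r, G (x, r) -> r <= rnorm x &
      forall p, G p -> G (x0, rnorm x0)].

Let is_graph_bigcup x0 (F : set (set (X * R))) :
  F `<=` is_graph x0 -> total_on F subset -> is_graph x0 (\bigcup_(G in F) G).
Proof.
move=> FG Ft; split.
- move=> x y r s [G FG1 Gx] [G' FG' Gy].
  have [GG|GG] := Ft _ _ FG1 FG'.
    by exists G' => //; case: (FG _ FG') => + _ _ _; apply => //; exact: GG.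
  by exists G => //; case: (FG _ FG1) => + _ _ _; apply => //; exact: GG.
- by move=> t x r [G FG1 Gx]; exists G => //; case: (FG _ FG1) => _ + _ _; apply.
- by move=> x r [G FG1 Gx]; case: (FG _ FG1) => _ _ + _; apply.
- by move=> p [G FG1 Gp]; exists G => //; case: (FG _ FG1) => _ _ _; apply; exact: Gp.
Qed.

Lemma real_hahn_banach (x0 : X) : exists g : X -> R,
  [/\ forall x y, g (x + y) = g x + g y,
      forall (t : R) x, g (t%:C *: x) = t * g x,
      forall x, g x <= rnorm x & g x0 = rnorm x0].
Proof.
have [A [AG Amax]] := Zorn_bigcup (@is_graph_bigcup x0).
have [AD AZ AB A0] := AG.
have Ax0 : A (x0, rnorm x0).
  apply: contrapT => nA.
  pose L : set (X * R) := [set p | exists t : R, p = (t%:C *: x0, t * rnorm x0)].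
  have L0 : L (x0, rnorm x0) by exists 1; rewrite rmorph1 scale1r mul1r.
  apply: (Amax L); first by split=> [p /A0//|LA]; apply: nA; exact: LA.
  split.
  - move=> x y r s [t [-> ->]] [t' [-> ->]]; exists (t + t').
    by rewrite rmorphD scalerDl mulrDl.
  - by move=> c x r [t [-> ->]]; exists (c * t); rewrite scalerA -rmorphM mulrA.
  - move=> x r [t [-> ->]]; rewrite rnormZr ler_wpM2r ?rnorm_ge0//.
    exact: ler_norm.
  - by move=> p _; exists 1; rewrite rmorph1 scale1r mul1r.
have A00 : A (0, 0) by have := AZ 0 _ _ Ax0; rewrite rmorph0 scale0r mul0r.
have Afun x r s : A (x, r) -> A (x, s) -> r = s.
  move=> Ar As.
  have h r' s' : A (x, r') -> A (x, s') -> r' <= s'.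
    move=> Ar' As'; have /(AD _ _ _ _ Ar') := AZ (-1) _ _ As'.
    by rewrite rmorphN rmorph1 scaleN1r subrr mulN1r => /AB; rewrite rnorm0 subr_le0.
  by apply/eqP; rewrite eq_le !h.
have Atot v : exists r, A (v, r).
  apply: contrapT => nv.
  pose S : set R := [set q.2 - rnorm (q.1 - v) | q in A].
  have Sub x r : A (x, r) -> ubound S (rnorm (x + v) - r).
    move=> Axr _ [[y s] Ays <-] /=; rewrite lerBlDr addrAC lerBrDr.
    rewrite (le_trans (AB _ _ (AD _ _ _ _ Ays Axr)))//.
    have -> : y + x = (x + v) + (y - v) by rewrite addrACA subrr addr0 addrC.
    exact: rnormD.
  have Ssup : has_sup S.
    split; first by exists (rnorm x0 - rnorm (x0 - v)), (x0, rnorm x0).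
    by exists (rnorm (x0 + v) - rnorm x0); exact: Sub.
  pose c := sup S.
  have c1 y s : A (y, s) -> s - rnorm (y - v) <= c.
    by move=> Ays; apply: sup_upper_bound => //; exists (y, s).
  have c2 x r : A (x, r) -> c <= rnorm (x + v) - r.
    by move=> Axr; apply: ge_sup; [exact: Ssup.1|exact: Sub].
  pose B : set (X * R) := [set p | exists x r (t : R),
    A (x, r) /\ p = (x + t%:C *: v, r + t * c)].
  have Bv : B (v, c).
    by exists 0, 0, 1; rewrite rmorph1 scale1r mul1r !add0r.
  apply: (Amax B).
    split; last by move=> /(_ _ Bv) Avc; apply: nv; exists c.
    move=> [x r] Axr; exists x, r, 0.
    by rewrite rmorph0 scale0r mul0r !addr0.
  split.
  - move=> x y r s [x1 [r1 [t1 [A1 [-> ->]]]]] [x2 [r2 [t2 [A2 [-> ->]]]]].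
    exists (x1 + x2), (r1 + r2), (t1 + t2); split; first exact: AD.
    by rewrite rmorphD scalerDl mulrDl !(addrACA _ _ x2) !(addrACA _ _ r2).
  - move=> t x r [x1 [r1 [t1 [A1 [-> ->]]]]].
    exists (t%:C *: x1), (t * r1), (t * t1); split; first exact: AZ.
    by rewrite scalerDr scalerA -rmorphM mulrDr mulrA.
  - move=> _ _ [x [r [t [Axr [-> ->]]]]].
    have [t0|t0|->] := ltgtP t 0; last first.
    + by rewrite rmorph0 scale0r mul0r !addr0 AB.
    + have /c2 := AZ t^-1 _ _ Axr.
      rewrite lerBrDl -(ler_pM2l t0) mulrDr mulrA divff ?gt_eqF// mul1r.
      move=> /le_trans; apply; rewrite -[X in X * _](ger0_norm (ltW t0)) -rnormZr.
      by rewrite scalerDr scalerA -rmorphM divff ?gt_eqF// rmorph1 scale1r.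
    + have nt0 : 0 < - t by rewrite oppr_gt0.
      have /c1 := AZ (- t)^-1 _ _ Axr.
      rewrite lerBlDr -lerBlDl -(ler_pM2l nt0) mulrBr mulrA divff ?gt_eqF//.
      rewrite mul1r mulNr opprK.
      move=> /le_trans; apply; rewrite -[X in X * _](ger0_norm (ltW nt0)) -rnormZr.
      rewrite scalerBr scalerA -rmorphM divff ?gt_eqF// rmorph1 scale1r.
      by rewrite rmorphN scaleNr opprK.
  - by move=> p _; exists x0, (rnorm x0), 0; rewrite rmorph0 scale0r mul0r !addr0.
have [g gA] := choice Atot.
exists g; split.
- by move=> x y; apply: Afun (gA _) _; exact: AD.
- by move=> t x; apply: Afun (gA _) _; exact: AZ.
- by move=> x; exact: AB.
- exact: Afun (gA _) _.
Qed.

Lemma hahn_banach (x0 : X) : exists f : dual X,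
  f x0 = (rnorm x0)%:C /\ rnorm f <= 1.
Proof.
have [g [gD gZ gB g0]] := real_hahn_banach x0.
have [J JE] : exists J : X -> X, forall x, J x = ('i%C : R[i]) *: x.
  by exists (fun x => 'i%C *: x).
pose f (x : X) : scalars R := (g x -i* g (J x)).
have gN x : g (- x) = - g x.
  by have := gZ (-1) x; rewrite rmorphN rmorph1 scaleN1r mulN1r.
have ii : 'i%C * 'i%C = -1 :> R[i] by exact: sqr_i.
have JJ x : J (J x) = - x.
  by rewrite -scaleN1r !JE scalerA; congr (_ *: _); exact: ii.
have JZ (c : R[i]) x : J (c *: x) = c *: J x.
  by rewrite !JE !scalerA [X in X *: _]mulrC.
have JD x y : J (x + y) = J x + J y by rewrite !JE scalerDr.
have fD x y : f (x + y) = f x + f y.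
  by rewrite /f JD !gD opprD.
have fZ (c : R[i]) x : f (c *: x) = c *: f x.
  case: c => a b.
  have cE : (a +i* b) *: x = a%:C *: x + b%:C *: J x.
    rewrite JE scalerA -scalerDl; congr (_ *: _).
    by rewrite [LHS]complexE/= mulrC.
  have cJ : J ((a +i* b) *: x) = a%:C *: J x - b%:C *: x.
    by rewrite cE JD !JZ JJ scalerN.
  rewrite /f cJ cE !gD gN !gZ.
  apply/eqP; rewrite eq_complex; apply/andP; split; apply/eqP => /=.
    by rewrite mulrN opprK.
  by rewrite opprB mulrN addrC.
have flin : linear f by move=> c x y; rewrite fD fZ.
have fB x : rnorm (f x) <= rnorm x.
  have [fx0|fx0] := eqVneq (f x : R[i]) 0.
    by rewrite fx0 rnorm0 rnorm_ge0.
  pose c : R[i] := `|f x : R[i]| / (f x : R[i]).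
  have nc : `|c| = 1.
    by rewrite normrM normfV normr_id divff// normr_eq0.
  have fc : f (c *: x) = `|f x|.
    by rewrite fZ -[LHS]/(c * (f x : R[i])) /c divfK.
  have -> : rnorm (f x) = g (c *: x) by rewrite /rnorm -fc.
  by rewrite (le_trans (gB _))// rnormZ nc mul1r.
have fbnd : exists M : R, forall x, rnorm (f x) <= M * rnorm x.
  by exists 1 => x; rewrite mul1r.
exists (BoundedLinear flin (mk_rbounded fbnd)); split.
  have fx0 : complex.Re (f x0 : R[i]) = rnorm x0 by rewrite /= g0.
  have : rnorm (f x0) = rnorm x0.
    apply/eqP; rewrite eq_le fB -fx0 /rnorm.
    by rewrite (le_trans _ (normc_geRe _))// ler_norm.
  rewrite /= /rnorm normc_def/= -/(rnorm x0) g0 => /eqP.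
  rewrite -(@eqrXn2 _ 2) ?sqrtr_ge0 ?rnorm_ge0// sqr_sqrtr ?addr_ge0 ?sqr_ge0//.
  rewrite sqrrN -subr_eq0 addrAC subrr add0r sqrf_eq0 => /eqP gJ0.
  by rewrite /f g0 gJ0 oppr0.
by apply: blin_norm_le => // x; rewrite mul1r fB.
Qed.

End HahnBanach.

Section Bilinear.
Context {R : realType}.
Implicit Types X Y Z : completeNormedModType R[i].

Definition mk_blin X Y (f : X -> Y) (flin : linear f)
    (fb : exists M : R, forall x, rnorm (f x) <= M * rnorm x) : 'L(X, Y) :=
  BoundedLinear flin (mk_rbounded fb).

Section MkBilin.
Variables (X Y Z : completeNormedModType R[i]) (f : X -> Y -> Z).
Hypothesis flinl : forall y, linear (f^~ y).
Hypothesis flinr : forall x, linear (f x).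
Hypothesis fb : exists M : R, forall x y, rnorm (f x y) <= M * (rnorm x * rnorm y).

Lemma bilin_rbounded : exists2 M : R, 0 <= M &
  forall x y, rnorm (f x y) <= M * (rnorm x * rnorm y).
Proof.
have [M fM] := fb; exists `|M| => // x y; rewrite (le_trans (fM x y))//.
by rewrite ler_wpM2r ?mulr_ge0 ?rnorm_ge0// ler_norm.
Qed.

Lemma bilin_bounded1 x : exists M : R, forall y, rnorm (f x y) <= M * rnorm y.
Proof.
by have [M fM] := fb; exists (M * rnorm x) => y; rewrite -mulrA.
Qed.

Definition bilin1 x : 'L(Y, Z) := mk_blin (flinr x) (bilin_bounded1 x).

Lemma bilin1_linear : linear bilin1.
Proof. by move=> a x x'; apply: blin_ext => y; exact: flinl. Qed.

Lemma bilin1_bounded : exists M : R, forall x, rnorm (bilin1 x) <= M * rnorm x.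
Proof.
have [M M0 fM] := bilin_rbounded; exists M => x.
by apply: blin_norm_le => [|y]; rewrite ?mulr_ge0 ?rnorm_ge0//= -mulrA.
Qed.

Definition mk_bilin : 'L(X, 'L(Y, Z)) := mk_blin bilin1_linear bilin1_bounded.

Lemma mk_bilin_norm_le M : 0 <= M ->
  (forall x y, rnorm (f x y) <= M * (rnorm x * rnorm y)) -> rnorm mk_bilin <= M.
Proof.
move=> M0 fM; apply: blin_norm_le => // x.
by apply: blin_norm_le => [|y]; rewrite ?mulr_ge0 ?rnorm_ge0//= -mulrA.
Qed.
End MkBilin.

Lemma blin_bilin_norm X Y Z (f : 'L(X, 'L(Y, Z))) x y :
  rnorm (f x y) <= rnorm f * (rnorm x * rnorm y).
Proof.
rewrite (le_trans (blin_normP _ _))// mulrA ler_wpM2r ?rnorm_ge0//.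
exact: blin_normP.
Qed.

End Bilinear.

(* Not necessarily unital. *)
Record banachAlgebra (R : realType) := BanachAlgebra {
  ba_sort :> completeNormedModType R[i];
  ba_mul : ba_sort -> ba_sort -> ba_sort;
  ba_mulA : associative ba_mul;
  ba_mul_linearl : forall b, linear (ba_mul^~ b);
  ba_mul_linearr : forall a, linear (ba_mul a);
  ba_mul_norm : forall a b, `|ba_mul a b| <= `|a| * `|b| }.

Declare Scope banach_scope.
Delimit Scope banach_scope with BA.
Local Open Scope banach_scope.
Notation "a ** b" := (ba_mul a b) (at level 40, left associativity) : banach_scope.

Section Modules.
Context {R : realType}.
Implicit Types (A B : banachAlgebra R) (X : completeNormedModType R[i]).

Record banachBimodule A X := BanachBimodule {
  lact : A -> X -> X;
  ract : X -> A -> X;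
  lact_linearl : forall x, linear (lact^~ x);
  lact_linearr : forall a, linear (lact a);
  ract_linearl : forall a, linear (ract^~ a);
  ract_linearr : forall x, linear (ract x);
  lactM : forall a b x, lact (a ** b) x = lact a (lact b x);
  ractM : forall x a b, ract x (a ** b) = ract (ract x a) b;
  lractA : forall a x b, lact a (ract x b) = ract (lact a x) b;
  lact_bounded : exists K : R, forall a x, `|lact a x| <= K%:C * (`|a| * `|x|);
  ract_bounded : exists K : R, forall x a, `|ract x a| <= K%:C * (`|x| * `|a|) }.

Lemma ba_rnorm A (a b : A) : rnorm (a ** b) <= rnorm a * rnorm b.
Proof. rewrite -lecR rmorphM/= -!rnormE; exact: ba_mul_norm. Qed.

Lemma lact_rbounded A X (m : banachBimodule A X) :
  exists2 K : R, 0 <= K & forall a x, rnorm (lact m a x) <= K * (rnorm a * rnorm x).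
Proof.
apply: bilin_rbounded; have [K mK] := lact_bounded m; exists K => a x.
rewrite -lecR !rmorphM/= -!rnormE; exact: mK.
Qed.

Lemma ract_rbounded A X (m : banachBimodule A X) :
  exists2 K : R, 0 <= K & forall x a, rnorm (ract m x a) <= K * (rnorm x * rnorm a).
Proof.
apply: bilin_rbounded; have [K mK] := ract_bounded m; exists K => a x.
rewrite -lecR !rmorphM/= -!rnormE; exact: mK.
Qed.

Definition commutative_bimodule A X (m : banachBimodule A X) : Prop :=
  forall a x, lact m a x = ract m x a.

Section Dual.
Variables (A : banachAlgebra R) (X : completeNormedModType R[i]).
Variable m : banachBimodule A X.

Lemma dual_lact_linear a (phi : dual X) : linear (fun x => phi (ract m x a)).
Proof. by move=> c x y; rewrite /= (ract_linearl m a c x y) blinD blinZ. Qed.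

Lemma dual_lact_bounded a (phi : dual X) :
  exists M : R, forall x, rnorm (phi (ract m x a)) <= M * rnorm x.
Proof.
have [K K0 mK] := ract_rbounded m; exists (rnorm phi * (K * rnorm a)) => x.
rewrite (le_trans (blin_normP _ _))// -mulrA ler_wpM2l ?rnorm_ge0//.
by rewrite (le_trans (mK _ _))// -mulrA ler_wpM2l// mulrC.
Qed.

(* <a . phi, x> = <phi, x . a> *)
Definition dual_lact (a : A) (phi : dual X) : dual X :=
  mk_blin (dual_lact_linear a phi) (dual_lact_bounded a phi).

Lemma dual_ract_linear (phi : dual X) a : linear (fun x => phi (lact m a x)).
Proof. by move=> c x y; rewrite /= (lact_linearr m a c x y) blinD blinZ. Qed.

Lemma dual_ract_bounded (phi : dual X) a :
  exists M : R, forall x, rnorm (phi (lact m a x)) <= M * rnorm x.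
Proof.
have [K K0 mK] := lact_rbounded m; exists (rnorm phi * (K * rnorm a)) => x.
rewrite (le_trans (blin_normP _ _))// -mulrA ler_wpM2l ?rnorm_ge0//.
by rewrite (le_trans (mK _ _))// -mulrA.
Qed.

(* <phi . a, x> = <phi, a . x> *)
Definition dual_ract (phi : dual X) (a : A) : dual X :=
  mk_blin (dual_ract_linear phi a) (dual_ract_bounded phi a).

Lemma dual_lact_linearl phi : linear (dual_lact^~ phi).
Proof.
move=> c a b; apply: blin_ext => x /=.
by rewrite (ract_linearr m x c a b) blinD blinZ.
Qed.

Lemma dual_lact_linearr a : linear (dual_lact a).
Proof. by move=> c a' b; apply: blin_ext => x. Qed.

Lemma dual_ract_linearl a : linear (dual_ract^~ a).
Proof. by move=> c a' b; apply: blin_ext => x. Qed.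

Lemma dual_ract_linearr phi : linear (dual_ract phi).
Proof.
move=> c a b; apply: blin_ext => x /=.
by rewrite (lact_linearl m x c a b) blinD blinZ.
Qed.

Lemma dual_lactM a b phi : dual_lact (a ** b) phi = dual_lact a (dual_lact b phi).
Proof. by apply: blin_ext => x /=; rewrite ractM. Qed.

Lemma dual_ractM phi a b : dual_ract phi (a ** b) = dual_ract (dual_ract phi a) b.
Proof. by apply: blin_ext => x /=; rewrite lactM. Qed.

Lemma dual_lractA a phi b :
  dual_lact a (dual_ract phi b) = dual_ract (dual_lact a phi) b.
Proof. by apply: blin_ext => x /=; rewrite lractA. Qed.

Lemma dual_lact_bound : exists K : R, forall a phi,
  `|dual_lact a phi| <= K%:C * (`|a| * `|phi|).
Proof.
have [K K0 mK] := ract_rbounded m; exists K => a phi.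
rewrite !rnormE -!rmorphM lecR; apply: blin_norm_le => [|x].
  by rewrite !mulr_ge0 ?rnorm_ge0.
rewrite (le_trans (blin_normP phi _))//.
have -> : K * (rnorm a * rnorm phi) * rnorm x = rnorm phi * (K * (rnorm x * rnorm a)).
  by ring.
by rewrite ler_wpM2l ?rnorm_ge0.
Qed.

Lemma dual_ract_bound : exists K : R, forall phi a,
  `|dual_ract phi a| <= K%:C * (`|phi| * `|a|).
Proof.
have [K K0 mK] := lact_rbounded m; exists K => phi a.
rewrite !rnormE -!rmorphM lecR; apply: blin_norm_le => [|x].
  by rewrite !mulr_ge0 ?rnorm_ge0.
rewrite (le_trans (blin_normP phi _))//.
have -> : K * (rnorm phi * rnorm a) * rnorm x = rnorm phi * (K * (rnorm a * rnorm x)).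
  by ring.
by rewrite ler_wpM2l ?rnorm_ge0.
Qed.

Definition dual_bimodule : banachBimodule A (dual X) :=
  BanachBimodule dual_lact_linearl dual_lact_linearr
    dual_ract_linearl dual_ract_linearr dual_lactM dual_ractM dual_lractA
    dual_lact_bound dual_ract_bound.

End Dual.

Section Arens.
Variable A : banachAlgebra R.

Lemma self_bound : exists K : R, forall a b : A,
  `|a ** b| <= K%:C * (`|a| * `|b|).
Proof. by exists 1 => a b; rewrite rmorph1 mul1r ba_mul_norm. Qed.

Definition self_bimodule : banachBimodule A A :=
  BanachBimodule (@ba_mul_linearl R A) (@ba_mul_linearr R A)
   (@ba_mul_linearl R A) (@ba_mul_linearr R A)
   (fun a b x => esym (ba_mulA a b x)) (@ba_mulA R A) (@ba_mulA R A)
   self_bound self_bound.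

(* <f . a, b> = <f, ab> *)
Local Notation "f <* a" := (ract (dual_bimodule self_bimodule) f a) (at level 40).

Lemma arens_lact_linear (G : dual (dual A)) (f : dual A) :
  linear (fun a => G (f <* a)).
Proof.
by move=> c a b; rewrite (ract_linearr (dual_bimodule self_bimodule) f) blinD blinZ.
Qed.

Lemma dual_self_norm (f : dual A) a : rnorm (f <* a) <= rnorm f * rnorm a.
Proof.
apply: blin_norm_le => [|b]; first by rewrite mulr_ge0 ?rnorm_ge0.
rewrite (le_trans (blin_normP f _))// -mulrA ler_wpM2l ?rnorm_ge0//.
exact: ba_rnorm.
Qed.

Lemma arens_lact_bounded (G : dual (dual A)) (f : dual A) :
  exists M : R, forall a, rnorm (G (f <* a)) <= M * rnorm a.
Proof.
exists (rnorm G * rnorm f) => a; rewrite (le_trans (blin_normP _ _))//.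
by rewrite -mulrA ler_wpM2l ?rnorm_ge0 ?dual_self_norm.
Qed.

(* <G . f, a> = <G, f . a> *)
Definition arens_lact (G : dual (dual A)) (f : dual A) : dual A :=
  mk_blin (arens_lact_linear G f) (arens_lact_bounded G f).

Lemma arens_lact_linearr G : linear (arens_lact G).
Proof.
move=> c f g; apply: blin_ext => a.
transitivity (G (c *: (f <* a) + (g <* a))); last by rewrite blinD blinZ.
by congr (G _); exact: blin_ext.
Qed.

Lemma arens_lact_norm G f : rnorm (arens_lact G f) <= rnorm G * rnorm f.
Proof.
apply: blin_norm_le => [|a]; first by rewrite mulr_ge0 ?rnorm_ge0.
rewrite (le_trans (blin_normP G _))// -mulrA ler_wpM2l ?rnorm_ge0//.
exact: dual_self_norm.
Qed.

Lemma arens_linear (F G : dual (dual A)) : linear (fun f => F (arens_lact G f)).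
Proof. by move=> c f g; rewrite arens_lact_linearr blinD blinZ. Qed.

Lemma arens_bounded (F G : dual (dual A)) :
  exists M : R, forall f, rnorm (F (arens_lact G f)) <= M * rnorm f.
Proof.
exists (rnorm F * rnorm G) => f; rewrite (le_trans (blin_normP _ _))//.
by rewrite -mulrA ler_wpM2l ?rnorm_ge0 ?arens_lact_norm.
Qed.

(* First Arens product: <F [] G, f> = <F, G . f>. *)
Definition arens_mul (F G : dual (dual A)) : dual (dual A) :=
  mk_blin (arens_linear F G) (arens_bounded F G).

Lemma arens_mulA : associative arens_mul.
Proof.
move=> F G H; apply: blin_ext => f /=; congr (F _).
apply: blin_ext => a /=; congr (G _); apply: blin_ext => b /=; congr (H _).
by apply: blin_ext => c /=; rewrite ba_mulA.
Qed.

Lemma arens_linearl G : linear (arens_mul^~ G).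
Proof. by move=> c F F'; apply: blin_ext. Qed.

Lemma arens_linearr F : linear (arens_mul F).
Proof.
move=> c G G'; apply: blin_ext => f /=.
rewrite -blinZ -blinD; congr (F _); exact: blin_ext.
Qed.

Lemma arens_norm F G : `|arens_mul F G| <= `|F| * `|G|.
Proof.
rewrite !rnormE -rmorphM lecR; apply: blin_norm_le => [|f].
  by rewrite mulr_ge0 ?rnorm_ge0.
rewrite (le_trans (blin_normP F _))//.
by rewrite -mulrA ler_wpM2l ?rnorm_ge0 ?arens_lact_norm.
Qed.

Definition second_dual : banachAlgebra R :=
  BanachAlgebra arens_mulA arens_linearl arens_linearr arens_norm.

End Arens.

Definition compatible_actions (U A : banachAlgebra R) (m : banachBimodule U A) :=
  (forall alpha (a b : A), lact m alpha (a ** b) = lact m alpha a ** b) /\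
  (forall (a b : A) alpha, ract m (a ** b) alpha = a ** ract m b alpha).

Definition second_dual_bimodule (U A : banachAlgebra R)
    (m : banachBimodule U A) : banachBimodule U (second_dual A) :=
  dual_bimodule (dual_bimodule m).

Lemma second_dual_compatible (U A : banachAlgebra R) (m : banachBimodule U A) :
  compatible_actions m -> compatible_actions (second_dual_bimodule m).
Proof.
move=> [ml mr]; split.
  move=> alpha F G; apply: blin_ext => f /=; congr (F _).
  apply: blin_ext => a /=; congr (G _).
  by apply: blin_ext => b /=; rewrite ml.
move=> F G alpha; apply: blin_ext => f /=; congr (F _).
apply: blin_ext => a /=; congr (G _).
by apply: blin_ext => b /=; rewrite mr.
Qed.

End Modules.

Section ProjectiveTensor.
Context {R : realType}.
Implicit Types X Y Z : completeNormedModType R[i].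

Lemma dual_norm_le Z (z : Z) (M : R) : 0 <= M ->
  (forall f : dual Z, rnorm (f z) <= M * rnorm f) -> rnorm z <= M.
Proof.
move=> M0 fM; have [f [fz f1]] := hahn_banach z.
have -> : rnorm z = rnorm (f z).
  by rewrite /rnorm fz normc_def/= expr0n addr0 sqrtr_sqr ger0_norm ?rnorm_ge0.
by rewrite (le_trans (fM f))// ler_piMr.
Qed.

Lemma dual_separates Z (z z' : Z) : (forall f : dual Z, f z = f z') -> z = z'.
Proof.
move=> ff; apply/eqP; rewrite -subr_eq0; apply/eqP/rnorm0_eq0/eqP.
rewrite eq_le rnorm_ge0 andbT; apply: dual_norm_le => // f.
by rewrite blinB ff subrr rnorm0 mul0r.
Qed.

Lemma closed_span_ind X (S P : set X) : is_closed_subspace P -> S `<=` P ->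
  forall u, closed_span S u -> P u.
Proof. by move=> Pc SP u; apply; split. Qed.

Lemma closed_span_sub X (S : set X) : S `<=` closed_span S.
Proof. by move=> x Sx P [_]; apply. Qed.

Lemma preimage_closed_subspace X Y (f : 'L(X, Y)) (P : set Y) :
  is_closed_subspace P -> is_closed_subspace (f @^-1` P).
Proof.
move=> [Pc P0 PD PZ]; split=> /=.
- apply/closed_seq => l lP; apply: (closed_seq P).1 => // e e0.
  have [|y Py yl] := lP (e / (rnorm f + 1)).
    by rewrite divr_gt0// ltr_wpDl ?rnorm_ge0.
  exists (f y) => //; rewrite -blinB (le_lt_trans (blin_normP _ _))//.
  rewrite (@le_lt_trans _ _ ((rnorm f + 1) * rnorm (y - l)))//.
    by rewrite ler_wpM2r ?rnorm_ge0// lerDl.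
  by rewrite mulrC -ltr_pdivlMr// ltr_wpDl ?rnorm_ge0.
- by rewrite blin0.
- by move=> x y Px Py; rewrite blinD; exact: PD.
- by move=> c x Px; rewrite blinZ; exact: PZ.
Qed.

Section Def.
Variables X Y : completeNormedModType R[i].
Local Notation Bil := 'L(X, dual Y).

Lemma evaluation_linear x y : linear (fun phi : Bil => phi x y : scalars R).
Proof. by []. Qed.

Lemma evaluation_bounded x y :
  exists M : R, forall phi : Bil, rnorm (phi x y) <= M * rnorm phi.
Proof.
by exists (rnorm x * rnorm y) => phi; rewrite mulrC; exact: blin_bilin_norm.
Qed.

Definition evaluation x y : dual Bil :=
  mk_blin (evaluation_linear x y) (evaluation_bounded x y).

(* The bounded bilinear forms on X x Y are the dual of X (x) Y with the
   projective norm.  By Hahn-Banach, X (x) Y embeds isometrically in the dual of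
   the space of these forms, and the projective tensor product, which is the
   completion of X (x) Y, is the closure of its image.  Lemmas tensor_norm,
   projtensor_universal and projtensor_unique below are the universal property
   that determines it up to isometric isomorphism. *)
Definition projtensor_space : closed_subspace (dual Bil) :=
  closed_span [set u | exists x y, u = evaluation x y].

Definition projtensor : completeNormedModType R[i] :=
  subspace_of projtensor_space.

Lemma evaluation_in x y : projtensor_space (evaluation x y).
Proof. by apply: closed_span_sub; exists x, y. Qed.

Definition tensor (x : X) (y : Y) : projtensor := SubspaceOf (evaluation_in x y).

Lemma tensor_linearl y : linear (tensor^~ y).
Proof.
move=> c x x'; apply: sub_ext; apply: blin_ext => phi /=.
by rewrite blinD blinZ.
Qed.

Lemma tensor_linearr x : linear (tensor x).
Proof.
move=> c y y'; apply: sub_ext; apply: blin_ext => phi /=.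
by rewrite blinD blinZ.
Qed.

Lemma tensor_norm x y : rnorm (tensor x y) <= rnorm x * rnorm y.
Proof.
rewrite sub_normE; apply: blin_norm_le => [|phi /=].
  by rewrite mulr_ge0 ?rnorm_ge0.
by rewrite mulrC; exact: blin_bilin_norm.
Qed.

Lemma projtensor_unique Z (S T : 'L(projtensor, Z)) :
  (forall x y, S (tensor x y) = T (tensor x y)) -> S = T.
Proof.
move=> ST; apply: blin_ext => -[u Hu].
pose P : set (dual Bil) :=
  [set u | exists Hu : projtensor_space u, S (SubspaceOf Hu) = T (SubspaceOf Hu)].
have SP : forall u, projtensor_space u -> P u.
  apply: closed_span_ind; last first.
    by move=> _ [x [y ->]]; exists (evaluation_in x y); exact: ST.
  split.
  - apply/closed_seq => l lP.
    have Hl : projtensor_space l.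
      apply: (closed_seq _).1 (@cs_closed _ _ projtensor_space) _ _ => e /lP[y [Hy _] yl].
      by exists y.
    exists Hl; apply/eqP; rewrite -subr_eq0 -blin_subE; apply/eqP.
    suff : ((S - T) @^-1` [set 0]) (SubspaceOf Hl) by [].
    have [C _ _ _] : is_closed_subspace ((S - T) @^-1` [set 0]).
      apply: preimage_closed_subspace; split=> //.
      + apply/closed_seq => z h; apply: rnorm0_eq0; apply/eqP.
        rewrite eq_le rnorm_ge0 andbT; apply/ler_addgt0Pr => e /h[_ -> ze].
        by rewrite add0r -rnormN -sub0r ltW.
      + by move=> x y -> ->; rewrite /= addr0.
      + by move=> c x ->; rewrite /= scaler0.
    apply: (closed_seq _).1 C _ _ => e /lP[y [Hy STy] yl].
    have h : (S - T) (SubspaceOf Hy) = 0 by rewrite blin_subE STy subrr.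
    by exists (SubspaceOf Hy).
  - exists (cs0 projtensor_space).
    rewrite (_ : SubspaceOf _ = 0) ?blin0//; exact: sub_ext.
  - move=> v w [Hv STv] [Hw STw]; exists (csD Hv Hw).
    rewrite (_ : SubspaceOf _ = SubspaceOf Hv + SubspaceOf Hw); last exact: sub_ext.
    by rewrite !blinD STv STw.
  - move=> c v [Hv STv]; exists (csZ c Hv).
    rewrite (_ : SubspaceOf _ = c *: SubspaceOf Hv); last exact: sub_ext.
    by rewrite !blinZ STv.
have [Hu' h] := SP u Hu.
by rewrite (Prop_irrelevance Hu Hu').
Qed.

Section Lift.
Variables (Z : completeNormedModType R[i]) (phi : 'L(X, 'L(Y, Z))).

Lemma comp_form_linearl (f : dual Z) y : linear (fun x => f (phi x y)).
Proof.
move=> c x x' /=; have -> : phi (c *: x + x') y = c *: phi x y + phi x' y.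
  by rewrite blinD blinZ.
by rewrite blinD blinZ.
Qed.

Lemma comp_form_linearr (f : dual Z) x : linear (fun y => f (phi x y)).
Proof.
move=> c y y' /=; have -> : phi x (c *: y + y') = c *: phi x y + phi x y'.
  by rewrite blinD blinZ.
by rewrite blinD blinZ.
Qed.

Lemma comp_form_norm (f : dual Z) x y :
  rnorm (f (phi x y)) <= rnorm f * rnorm phi * (rnorm x * rnorm y).
Proof.
rewrite (le_trans (blin_normP f _))// -mulrA ler_wpM2l ?rnorm_ge0//.
exact: blin_bilin_norm.
Qed.

Definition comp_form (f : dual Z) : Bil :=
  mk_bilin (comp_form_linearl f) (comp_form_linearr f)
    (ex_intro _ _ (comp_form_norm f)).

Lemma comp_form_rnorm f : rnorm (comp_form f) <= rnorm f * rnorm phi.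
Proof.
apply: mk_bilin_norm_le => [|x y]; first by rewrite mulr_ge0 ?rnorm_ge0.
exact: comp_form_norm.
Qed.

Let represents (u : dual Bil) (z : Z) := forall f, u (comp_form f) = f z.

Let represents_norm u z : represents u z -> rnorm z <= rnorm u * rnorm phi.
Proof.
move=> uz; apply: dual_norm_le => [|f]; first by rewrite mulr_ge0 ?rnorm_ge0.
rewrite -uz (le_trans (blin_normP u _))// -mulrA ler_wpM2l ?rnorm_ge0//.
by rewrite mulrC comp_form_rnorm.
Qed.

Let representsD u v y z :
  represents u y -> represents v z -> represents (u + v) (y + z).
Proof. by move=> uy vz f; rewrite blin_addE uy vz blinD. Qed.

Let representsZ (c : R[i]) u y : represents u y -> represents (c *: u) (c *: y).
Proof. by move=> uy f; rewrite blin_scaleE uy blinZ. Qed.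

Let representsB u v y z :
  represents u y -> represents v z -> represents (u - v) (y - z).
Proof.
move=> uy vz; rewrite -(scaleN1r v) -(scaleN1r z).
by apply: representsD => //; exact: representsZ.
Qed.

Let represents_closed : is_closed_subspace [set u | exists z, represents u z].
Proof.
split=> /=.
- apply/closed_seq => u uP.
  have ex n : exists p : dual Bil * Z,
      represents p.1 p.2 /\ rnorm (p.1 - u) < n.+1%:R^-1.
    have [|v [z vz] vu] := uP n.+1%:R^-1; first by rewrite invr_gt0 ltr0n.
    by exists (v, z).
  have [p hp] := choice ex.
  have c0 : 0 < 2 * rnorm phi + 1 by rewrite ltr_wpDl// mulr_ge0 ?rnorm_ge0.
  have [|z pz] := @banach_cauchy R Z (fun n => (p n).2).
    move=> e e0; have [N Ne] := archi (divr_gt0 e0 c0).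
    exists N => n m Nn Nm.
    have := represents_norm (representsB (hp n).1 (hp m).1).
    move=> /le_lt_trans; apply; rewrite ltr_pdivlMr// mulrDr mulr1 in Ne.
    apply: le_lt_trans Ne; rewrite mulrCA mulrA -[leLHS]addr0 lerD ?invr_ge0//.
    rewrite ler_wpM2r ?rnorm_ge0// mulrC -[2]/(1 + 1) mulrDr mulr1.
    rewrite (le_trans (rnorm_tri _ u _))// lerD//.
      by rewrite (le_trans (ltW (hp n).2))// archi_le.
    by rewrite rnorm_sym (le_trans (ltW (hp m).2))// archi_le.
  exists z => f; apply/eqP; rewrite -subr_eq0; apply/eqP/rnorm0_eq0/eqP.
  rewrite eq_le rnorm_ge0 andbT; apply/ler_addgt0Pr => e e0; rewrite add0r.
  have e2 : 0 < e / 2 by rewrite divr_gt0.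
  have k0 : 0 < rnorm (comp_form f) + 1 by rewrite ltr_wpDl ?rnorm_ge0.
  have f0 : 0 < rnorm f + 1 by rewrite ltr_wpDl ?rnorm_ge0.
  have [N1 h1] := archi (divr_gt0 e2 k0).
  have [N2 h2] := pz _ (divr_gt0 e2 f0).
  pose n := maxn N1 N2.
  rewrite (le_trans (rnorm_tri _ ((p n).1 (comp_form f)) _))// (splitr e) lerD//.
    rewrite -blin_subE (le_trans (blin_normP (u - (p n).1) _))//.
    rewrite rnorm_sym (@le_trans _ _ (N1.+1%:R^-1 * (rnorm (comp_form f) + 1)))//.
      rewrite ler_pM ?rnorm_ge0 ?lerDl//.
      by rewrite (le_trans (ltW (hp n).2))// archi_le// leq_maxl.
    by rewrite -ler_pdivlMr// ltW.
  rewrite (hp n).1 -blinB (le_trans (blin_normP f _))//.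
  rewrite (@le_trans _ _ ((rnorm f + 1) * (e / 2 / (rnorm f + 1))))//.
    by rewrite ler_pM ?rnorm_ge0 ?lerDl// ltW// h2// leq_maxr.
  by rewrite mulrC divfK ?gt_eqF.
- by exists 0 => f; rewrite !blin0.
- by move=> u v [y uy] [z vz]; exists (y + z); exact: representsD.
- by move=> c u [y uy]; exists (c *: y); exact: representsZ.
Qed.

Let lift_ex (u : projtensor) : exists z, represents (sub_val u) z.
Proof.
apply: (closed_span_ind represents_closed) (sub_valP u) => _ [x [y ->]].
by exists (phi x y).
Qed.

Let lift (u : projtensor) : Z := projT1 (cid (lift_ex u)).

Let liftP u : represents (sub_val u) (lift u).
Proof. by rewrite /lift; case: cid. Qed.

Let lift_eq u z : represents (sub_val u) z -> lift u = z.
Proof. by move=> uz; apply: dual_separates => f; rewrite -liftP uz. Qed.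

Let lift_linear : linear lift.
Proof.
move=> c u v; apply: lift_eq; apply: representsD; last exact: liftP.
by apply: representsZ; exact: liftP.
Qed.

Let lift_bounded : exists M : R, forall u, rnorm (lift u) <= M * rnorm u.
Proof.
by exists (rnorm phi) => u; rewrite mulrC; exact: represents_norm (liftP u).
Qed.

Lemma projtensor_universal : exists T : 'L(projtensor, Z),
  (forall x y, T (tensor x y) = phi x y) /\ rnorm T <= rnorm phi.
Proof.
exists (mk_blin lift_linear lift_bounded); split => [x y|].
  exact: lift_eq.
apply: blin_norm_le; first exact: rnorm_ge0.
by move=> u; rewrite mulrC; exact: represents_norm (liftP u).
Qed.

Definition projtensor_lift : 'L(projtensor, Z) :=
  projT1 (cid projtensor_universal).

Lemma projtensor_liftE x y : projtensor_lift (tensor x y) = phi x y.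
Proof. by rewrite /projtensor_lift; case: cid => T []. Qed.

End Lift.
End Def.

Section TensorAlgebra.
Variables A B : banachAlgebra R.
Local Open Scope banach_scope.
Local Notation Bil := 'L(A, dual B).
Implicit Types (phi : Bil) (u v w : dual Bil).

Lemma shift_linearl phi a b d : linear (fun c : A => phi (a ** c) (b ** d)).
Proof. by move=> k c c'; rewrite /= ba_mul_linearr blinD blinZ. Qed.

Lemma shift_linearr phi a b c : linear (fun d : B => phi (a ** c) (b ** d)).
Proof. by move=> k d d'; rewrite /= ba_mul_linearr blinD blinZ. Qed.

Lemma shift_norm phi a b c d : rnorm (phi (a ** c) (b ** d)) <=
  rnorm phi * (rnorm a * rnorm b) * (rnorm c * rnorm d).
Proof.
rewrite (le_trans (blin_bilin_norm _ _ _))// -mulrA ler_wpM2l ?rnorm_ge0//.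
by rewrite mulrACA ler_pM ?rnorm_ge0 ?ba_rnorm.
Qed.

Definition shift phi a b : Bil :=
  mk_bilin (shift_linearl phi a b) (shift_linearr phi a b)
    (ex_intro _ _ (shift_norm phi a b)).

Lemma shift_rnorm phi a b :
  rnorm (shift phi a b) <= rnorm phi * (rnorm a * rnorm b).
Proof.
apply: mk_bilin_norm_le => [|c d]; first by rewrite !mulr_ge0 ?rnorm_ge0.
exact: shift_norm.
Qed.

Lemma slice_linearl v phi b : linear (fun a => v (shift phi a b)).
Proof.
move=> k a a'; rewrite -blinZ -blinD; congr (v _).
apply: blin_ext => c; apply: blin_ext => d /=.
by rewrite ba_mul_linearl blinD blinZ.
Qed.

Lemma slice_linearr v phi a : linear (fun b => v (shift phi a b)).
Proof.
move=> k b b'; rewrite -blinZ -blinD; congr (v _).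
apply: blin_ext => c; apply: blin_ext => d /=.
by rewrite ba_mul_linearl blinD blinZ.
Qed.

Lemma slice_norm v phi a b : rnorm (v (shift phi a b)) <=
  rnorm v * rnorm phi * (rnorm a * rnorm b).
Proof.
rewrite (le_trans (blin_normP v _))// -mulrA ler_wpM2l ?rnorm_ge0//.
exact: shift_rnorm.
Qed.

Definition slice v phi : Bil :=
  mk_bilin (slice_linearl v phi) (slice_linearr v phi)
    (ex_intro _ _ (slice_norm v phi)).

Lemma slice_rnorm v phi : rnorm (slice v phi) <= rnorm v * rnorm phi.
Proof.
apply: mk_bilin_norm_le => [|c d]; first by rewrite !mulr_ge0 ?rnorm_ge0.
exact: slice_norm.
Qed.

Lemma slice_linear v : linear (slice v).
Proof.
move=> k phi psi; apply: blin_ext => a; apply: blin_ext => b.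
have E : shift (k *: phi + psi) a b = k *: shift phi a b + shift psi a b.
  by apply: blin_ext => c; apply: blin_ext => d /=; reflexivity.
transitivity (v (shift (k *: phi + psi) a b)) => //.
by rewrite E blinD blinZ.
Qed.

Lemma bimul_linear u v : linear (fun phi => u (slice v phi)).
Proof. by move=> k phi psi; rewrite slice_linear blinD blinZ. Qed.

Lemma bimul_norm u v phi :
  rnorm (u (slice v phi)) <= rnorm u * rnorm v * rnorm phi.
Proof.
rewrite (le_trans (blin_normP u _))// -mulrA ler_wpM2l ?rnorm_ge0//.
exact: slice_rnorm.
Qed.

(* <u v, phi> = <u, (a, b) |-> <v, (c, d) |-> phi (ac, bd)>>; on elementary
   tensors this is (a (x) b) (c (x) d) = ac (x) bd, see bimul_evaluation. *)
Definition bimul u v : dual Bil :=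
  mk_blin (bimul_linear u v) (ex_intro _ _ (bimul_norm u v)).

Lemma bimul_evaluation a b c d :
  bimul (evaluation a b) (evaluation c d) = evaluation (a ** c) (b ** d).
Proof. exact: blin_ext. Qed.

Lemma bimul_rnorm u v : rnorm (bimul u v) <= rnorm u * rnorm v.
Proof.
apply: blin_norm_le => [|phi]; first by rewrite mulr_ge0 ?rnorm_ge0.
exact: bimul_norm.
Qed.

Lemma bimulA : associative bimul.
Proof.
move=> u v w; apply: blin_ext => phi /=; congr (u _).
apply: blin_ext => a; apply: blin_ext => b /=; congr (v _).
apply: blin_ext => c; apply: blin_ext => d /=; congr (w _).
by apply: blin_ext => e; apply: blin_ext => f /=; rewrite !ba_mulA.
Qed.

Lemma bimul_linearl v : linear (bimul^~ v).
Proof. by move=> k u u'; apply: blin_ext => phi /=; reflexivity. Qed.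

Lemma bimul_linearr u : linear (bimul u).
Proof.
move=> k v v'; apply: blin_ext => phi.
have E : slice (k *: v + v') phi = k *: slice v phi + slice v' phi.
  by apply: blin_ext => a; apply: blin_ext => b /=; reflexivity.
transitivity (u (slice (k *: v + v') phi)) => //.
by rewrite E blinD blinZ.
Qed.

Lemma bimul_bounded_linear :
  exists M : R, forall u v, rnorm (bimul u v) <= M * (rnorm u * rnorm v).
Proof. by exists 1 => u v; rewrite mul1r bimul_rnorm. Qed.

Let bimulL : 'L(dual Bil, 'L(dual Bil, dual Bil)) :=
  mk_bilin bimul_linearl bimul_linearr bimul_bounded_linear.

Let bimulR_bounded v :
  exists M : R, forall u, rnorm (bimul u v) <= M * rnorm u.
Proof. by exists (rnorm v) => u; rewrite mulrC bimul_rnorm. Qed.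

Let bimulR v : 'L(dual Bil, dual Bil) :=
  mk_blin (bimul_linearl v) (bimulR_bounded v).

Local Notation P := (projtensor_space A B).

Lemma bimul_closed u v : P u -> P v -> P (bimul u v).
Proof.
move=> Pu Pv.
have h1 a b w : P w -> P (bimul (evaluation a b) w).
  apply: (@closed_span_ind _ _ (bimulL (evaluation a b) @^-1` cs_set P)).
    by apply: preimage_closed_subspace; exact: cs_axiom.
  move=> _ [c [d ->]]; rewrite /= bimul_evaluation; exact: evaluation_in.
suff : (bimulR v @^-1` cs_set P) u by [].
apply: closed_span_ind Pu.
  by apply: preimage_closed_subspace; exact: cs_axiom.
by move=> _ [a [b ->]]; exact: h1.
Qed.

Definition projtensor_mul (u v : projtensor A B) : projtensor A B :=
  SubspaceOf (bimul_closed (sub_valP u) (sub_valP v)).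

Lemma projtensor_mulA : associative projtensor_mul.
Proof. by move=> u v w; apply: sub_ext; exact: bimulA. Qed.
Lemma projtensor_linearl (v : projtensor A B) : linear (projtensor_mul^~ v).
Proof. by move=> k u u'; apply: sub_ext; exact: bimul_linearl. Qed.
Lemma projtensor_linearr (u : projtensor A B) : linear (projtensor_mul u).
Proof. by move=> k v v'; apply: sub_ext; exact: bimul_linearr. Qed.
Lemma projtensor_mul_norm (u v : projtensor A B) :
  `|projtensor_mul u v| <= `|u| * `|v|.
Proof. by rewrite !rnormE -rmorphM lecR; exact: bimul_rnorm. Qed.

Definition projtensor_algebra : banachAlgebra R :=
  BanachAlgebra projtensor_mulA projtensor_linearl projtensor_linearr
    projtensor_mul_norm.

Lemma projtensor_mulE a b c d :
  projtensor_mul (tensor a b) (tensor c d) = tensor (a ** c) (b ** d).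
Proof. by apply: sub_ext; exact: bimul_evaluation. Qed.

End TensorAlgebra.

Section Ideals.
Variable A : banachAlgebra R.
Local Open Scope banach_scope.

(* Ideals are two-sided. *)
Definition is_closed_ideal (I : set A) : Prop :=
  [/\ is_closed_subspace I, forall a x, I x -> I (a ** x) &
      forall x a, I x -> I (x ** a)].

Lemma is_closed_idealW I : is_closed_ideal I -> is_closed_subspace I.
Proof. by case. Qed.

Definition closed_ideal_gen (S : set A) : closed_subspace A :=
  ClosedSubspace (closed_subspace_smallest S is_closed_idealW).

Lemma closed_ideal_genP S : is_closed_ideal (cs_set (closed_ideal_gen S)).
Proof.
split; first exact: cs_axiom.
  by move=> a x Sx I CI; case: (CI) => -[_ Il _] _; apply: Il; exact: (Sx I CI).
by move=> x a Sx I CI; case: (CI) => -[_ _ Ir] _; apply: Ir; exact: (Sx I CI).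
Qed.

Lemma self_mul_bounded : exists M : R, forall a b : A,
  rnorm (a ** b) <= M * (rnorm a * rnorm b).
Proof. by exists 1 => a b; rewrite mul1r ba_rnorm. Qed.

Definition mul_bilin : 'L(A, 'L(A, A)) :=
  mk_bilin (@ba_mul_linearl R A) (@ba_mul_linearr R A) self_mul_bounded.

Definition product_map : 'L(projtensor A A, A) := projtensor_lift mul_bilin.

Lemma product_mapE a b : product_map (tensor a b) = a ** b.
Proof. exact: projtensor_liftE. Qed.

End Ideals.
End ProjectiveTensor.

Section ModuleAmenability.
Context {R : realType}.
Local Open Scope banach_scope.
Implicit Types (U A B : banachAlgebra R) (X : completeNormedModType R[i]).

(* This is I when B = A, and M when B = A**. *)
Definition tensor_ideal U B (m : banachBimodule U B) :
    closed_subspace (projtensor_algebra B B) :=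
  @closed_ideal_gen R (projtensor_algebra B B)
    [set u | exists alpha (a b : B),
       u = tensor (lact m alpha a) b - tensor a (ract m b alpha)].

(* This is J when B = A, and N when B = A**. *)
Definition module_ideal U B (m : banachBimodule U B) : closed_subspace B :=
  closed_ideal_gen [set product_map B u | u in cs_set (tensor_ideal m)].

Definition induced_actions U B (m : banachBimodule U B) (J : closed_subspace B)
    (q : banachBimodule U (quotient_by J)) : Prop :=
  (forall alpha b, lact q alpha (quot_pi J b) = quot_pi J (lact m alpha b)) /\
  (forall b alpha, ract q (quot_pi J b) alpha = quot_pi J (ract m b alpha)).

(* The induced actions exist exactly when J is stable under the actions on B;
   this is part of the assertion. *)
Definition commutative_quotient U B (m : banachBimodule U B)
    (J : closed_subspace B) : Prop :=
  exists q : banachBimodule U (quotient_by J),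
    induced_actions m q /\ commutative_bimodule q.

Record compatible_bimodules U B X (m : banachBimodule U B)
    (XB : banachBimodule B X) (XU : banachBimodule U X) : Prop := {
  compat_lll : forall alpha b x,
    lact XU alpha (lact XB b x) = lact XB (lact m alpha b) x;
  compat_lrl : forall b alpha x,
    lact XB b (lact XU alpha x) = lact XB (ract m b alpha) x;
  compat_llr : forall alpha x b,
    ract XB (lact XU alpha x) b = lact XU alpha (ract XB x b);
  compat_rrr : forall x b alpha,
    ract XU (ract XB x b) alpha = ract XB x (ract m b alpha);
  compat_rlr : forall x alpha b,
    ract XB (ract XU x alpha) b = ract XB x (lact m alpha b);
  compat_lrr : forall b x alpha,
    lact XB b (ract XU x alpha) = ract XU (lact XB b x) alpha }.

(* D is not assumed to be C-linear. *)
Record module_derivation U B X (m : banachBimodule U B)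
    (XB : banachBimodule B X) (XU : banachBimodule U X) (D : B -> X) : Prop := {
  mder_bounded : exists C : R, forall a, `|D a| <= C%:C * `|a|;
  mder_add : forall a b, D (a + b) = D a + D b;
  mder_sub : forall a b, D (a - b) = D a - D b;
  mder_mul : forall a b, D (a ** b) = ract XB (D a) b + lact XB a (D b);
  mder_lact : forall alpha a, D (lact m alpha a) = lact XU alpha (D a);
  mder_ract : forall a alpha, D (ract m a alpha) = ract XU (D a) alpha }.

Definition inner_derivation B X (XB : banachBimodule B X) (D : B -> X) : Prop :=
  exists x, forall a, D a = lact XB a x - ract XB x a.

Definition module_amenable U B (m : banachBimodule U B) : Prop :=
  forall X (XB : banachBimodule B X) (XU : banachBimodule U X),
    compatible_bimodules m XB XU -> commutative_bimodule XU ->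
    forall D : B -> dual X,
      module_derivation m (dual_bimodule XB) (dual_bimodule XU) D ->
      inner_derivation (dual_bimodule XB) D.

End ModuleAmenability.

(* Main.v *)
Require Import Defs.
From HB Require Import structures.
From mathcomp Require Import all_boot all_order all_algebra.
From mathcomp Require Import complex.
From mathcomp Require Import boolp classical_sets reals topology normedtype.
From mathcomp Require Import ring.

(** The idea is to extend a module derivation D : A -> X* to A** by taking its
second adjoint, to apply module amenability of A** there, and to restrict the
implementing functional back to X.

For C-linear D the second adjoint D** : A** -> X*** is again a derivation, for
the bimodule structure of W = X*** over A** in which both actions are third
adjoints in the sense of Arens ([arens_ext], [bidual_bimodule]): all the
identities needed are the identities of A and X*, read through iterated
evaluations of functionals. The A**-bimodule W need not be a dual module, but W**
is the dual of the A**-module W*; so D** is composed with the canonical embedding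
of W into W**. Module amenability yields xi in W** implementing this derivation,
and evaluating xi on the image of X in W*, its fourth dual, gives an element of
X* implementing D, since the canonical embeddings commute with the actions of A.
This is [linear_derivation_inner]. The actions of the second algebra pass to each
dual, with compatibility and commutativity preserved.

A module derivation need not be C-linear, though it is R-linear, being additive
and bounded ([additive_bounded_rscale]). Its defect E a = D a + i D (i a) is
conjugate linear, and comparing i(ab) = (ia)b = a(ib) in the Leibniz rule shows
that E vanishes on products. Conjugating twice extends E to a conjugate linear
map A** -> X* vanishing on products, that is, to a module derivation into the
dual of X with the zero action of A**. Inner derivations into that module are
zero, so E = 0 and D is C-linear after all ([module_derivation_scale_i]). *)

Set Implicit Arguments.
Unset Strict Implicit.
Unset Printing Implicit Defensive.

Import Order.TTheory GRing.Theory Num.Theory.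
Import numFieldNormedType.Exports.

Local Open Scope ring_scope.
Local Open Scope complex_scope.
Local Open Scope banach_scope.

(** * Adjoints of bounded linear and bilinear maps *)

Section LinearMaps.
Context {K : pzRingType} {V W : lmodType K} (f : V -> W).
Hypothesis flin : linear f.

Lemma linear_map0 : f 0 = 0.
Proof.
by have := flin (-1) 0 0; rewrite !scaleN1r oppr0 addr0 addNr.
Qed.

Lemma linear_mapZ (c : K) x : f (c *: x) = c *: f x.
Proof. by have := flin c x 0; rewrite linear_map0 !addr0. Qed.

Lemma linear_mapD x y : f (x + y) = f x + f y.
Proof. by have := flin 1 x y; rewrite !scale1r. Qed.

End LinearMaps.

Section Duality.
Context {R : realType}.
Implicit Types X Y Z : completeNormedModType R[i].

Lemma blin_comp_linear X Y Z (g : 'L(Y, Z)) (f : 'L(X, Y)) :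
  linear (fun x => g (f x)).
Proof. by move=> c x y; rewrite !blinD !blinZ. Qed.

Lemma blin_comp_norm X Y Z (g : 'L(Y, Z)) (f : 'L(X, Y)) x :
  rnorm (g (f x)) <= rnorm g * rnorm f * rnorm x.
Proof.
rewrite (le_trans (blin_normP g _))// -mulrA ler_wpM2l ?rnorm_ge0//.
exact: blin_normP.
Qed.

Definition blin_comp X Y Z (g : 'L(Y, Z)) (f : 'L(X, Y)) : 'L(X, Z) :=
  mk_blin (blin_comp_linear g f) (ex_intro _ _ (blin_comp_norm g f)).

Lemma transpose_linear X Y (f : 'L(X, Y)) :
  linear (fun g : dual Y => blin_comp g f : dual X).
Proof. by move=> c g h; apply: blin_ext. Qed.

Lemma transpose_bounded X Y (f : 'L(X, Y)) : exists M : R,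
  forall g : dual Y, rnorm (blin_comp g f : dual X) <= M * rnorm g.
Proof.
exists (rnorm f) => g; apply: blin_norm_le => [|x].
  by rewrite mulr_ge0 ?rnorm_ge0.
by rewrite (mulrC (rnorm f)); exact: blin_comp_norm.
Qed.

Definition transpose X Y (f : 'L(X, Y)) : 'L(dual Y, dual X) :=
  mk_blin (transpose_linear f) (transpose_bounded f).

Lemma canon_linear X (x : X) : linear (fun f : dual X => f x).
Proof. by []. Qed.

Lemma canon_norm X (x : X) (f : dual X) : rnorm (f x) <= rnorm x * rnorm f.
Proof. by rewrite mulrC; exact: blin_normP. Qed.

Definition canon_fun X (x : X) : dual (dual X) :=
  mk_blin (@canon_linear X x) (ex_intro _ _ (canon_norm x)).

Lemma canon_fun_linear X : linear (@canon_fun X).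
Proof. by move=> c x y; apply: blin_ext => f /=; rewrite blinD blinZ. Qed.

Lemma canon_fun_bounded X :
  exists M : R, forall x : X, rnorm (canon_fun x) <= M * rnorm x.
Proof.
exists 1 => x; rewrite mul1r; apply: blin_norm_le; first exact: rnorm_ge0.
exact: canon_norm.
Qed.

Definition canon X : 'L(X, dual (dual X)) :=
  mk_blin (@canon_fun_linear X) (@canon_fun_bounded X).

Lemma adjoint_linear X Y Z (phi : 'L(X, 'L(Y, Z))) : linear (comp_form phi).
Proof. by move=> c f g; apply: blin_ext => x; apply: blin_ext. Qed.

Lemma adjoint_bounded X Y Z (phi : 'L(X, 'L(Y, Z))) :
  exists M : R, forall f, rnorm (comp_form phi f) <= M * rnorm f.
Proof. by exists (rnorm phi) => f; rewrite mulrC comp_form_rnorm. Qed.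

Definition adjoint X Y Z (phi : 'L(X, 'L(Y, Z))) :
    'L(dual Z, 'L(X, dual Y)) :=
  mk_blin (adjoint_linear phi) (adjoint_bounded phi).

Lemma blin_linearl X Y Z (phi : 'L(X, 'L(Y, Z))) (y : Y) :
  linear (fun x => phi x y : Z).
Proof. by move=> c x x'; rewrite blinD blinZ. Qed.

Lemma bilin_complex_bound X Y Z (phi : 'L(X, 'L(Y, Z))) : exists K : R,
  forall x y, `|phi x y| <= K%:C * (`|x| * `|y|).
Proof.
exists (rnorm phi) => x y; rewrite !rnormE -!rmorphM lecR.
exact: blin_bilin_norm.
Qed.

(** The third adjoint is the first Arens extension of phi:
    arens_ext phi F G f = F (x |-> G (y |-> f (phi x y))). *)
Definition arens_ext X Y Z (phi : 'L(X, 'L(Y, Z))) :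
    'L(dual (dual X), 'L(dual (dual Y), dual (dual Z))) :=
  adjoint (adjoint (adjoint phi)).

End Duality.

(** * The bidual of a bimodule, over the bidual of the algebra *)

Section ArensModule.
Context {R : realType} (A : banachAlgebra R).
Variables (E : completeNormedModType R[i]) (m : banachBimodule A E).

Lemma lact_bilin_bounded : exists K : R, forall a x,
  rnorm (lact m a x) <= K * (rnorm a * rnorm x).
Proof. by have [K _ mK] := lact_rbounded m; exists K. Qed.

Lemma ract_bilin_bounded : exists K : R, forall x a,
  rnorm (ract m x a) <= K * (rnorm x * rnorm a).
Proof. by have [K _ mK] := ract_rbounded m; exists K. Qed.

Definition lact_bilin : 'L(A, 'L(E, E)) :=
  mk_bilin (lact_linearl m) (lact_linearr m) lact_bilin_bounded.

Definition ract_bilin : 'L(E, 'L(A, E)) :=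
  mk_bilin (ract_linearl m) (ract_linearr m) ract_bilin_bounded.

Let W := dual (dual E).
Let B := second_dual A.

(** Both actions use the first Arens extension, although A stands on different
sides: in each, the left factor is the outer functional, and this common
order of evaluation is what makes the two actions associate with each other
and with the first Arens product. *)
Definition bidual_lact (F : B) (w : W) : W := arens_ext lact_bilin F w.
Definition bidual_ract (w : W) (F : B) : W := arens_ext ract_bilin w F.

Lemma bidual_lactM F G w :
  bidual_lact (F ** G) w = bidual_lact F (bidual_lact G w).
Proof.
apply: blin_ext => f; congr (F _); apply: blin_ext => a; congr (G _).
apply: blin_ext => b; congr (w _); apply: blin_ext => x.
by rewrite /= lactM.
Qed.

Lemma bidual_ractM w F G :
  bidual_ract w (F ** G) = bidual_ract (bidual_ract w F) G.
Proof.
apply: blin_ext => f; congr (w _); apply: blin_ext => x; congr (F _).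
apply: blin_ext => a; congr (G _); apply: blin_ext => b.
by rewrite /= ractM.
Qed.

Lemma bidual_lractA F w G :
  bidual_lact F (bidual_ract w G) = bidual_ract (bidual_lact F w) G.
Proof.
apply: blin_ext => f; congr (F _); apply: blin_ext => a; congr (w _).
apply: blin_ext => x; congr (G _); apply: blin_ext => b.
by rewrite /= lractA.
Qed.

Definition bidual_bimodule : banachBimodule B W :=
  @BanachBimodule R B W bidual_lact bidual_ract
    (blin_linearl (arens_ext lact_bilin))
    (fun F => blin_linear (arens_ext lact_bilin F))
    (blin_linearl (arens_ext ract_bilin))
    (fun w => blin_linear (arens_ext ract_bilin w))
    bidual_lactM bidual_ractM bidual_lractA
    (bilin_complex_bound (arens_ext lact_bilin))
    (bilin_complex_bound (arens_ext ract_bilin)).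

End ArensModule.

Section Compatibility.
Context {R : realType} (U A : banachAlgebra R) (m : banachBimodule U A).

(** Passing to the dual exchanges the left and right actions, hence the six
compatibility conditions among themselves. *)
Lemma dual_compatible (X : completeNormedModType R[i])
    (XA : banachBimodule A X) (XU : banachBimodule U X) :
  compatible_bimodules m XA XU ->
  compatible_bimodules m (dual_bimodule XA) (dual_bimodule XU).
Proof.
case=> h1 h2 h3 h4 h5 h6; split=> *; apply: blin_ext => x /=; congr (_ _).
- exact: h5.
- exact: h4.
- exact: esym (h6 _ _ _).
- exact: h2.
- exact: h1.
- exact: esym (h3 _ _ _).
Qed.

Lemma dual_commutative (X : completeNormedModType R[i])
    (XU : banachBimodule U X) :
  commutative_bimodule XU -> commutative_bimodule (dual_bimodule XU).
Proof. by move=> c a f; apply: blin_ext => x /=; rewrite c. Qed.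

Lemma bidual_compatible (E : completeNormedModType R[i])
    (EA : banachBimodule A E) (EU : banachBimodule U E) :
  compatible_bimodules m EA EU ->
  compatible_bimodules (second_dual_bimodule m) (bidual_bimodule EA)
    (dual_bimodule (dual_bimodule EU)).
Proof.
case=> h1 h2 h3 h4 h5 h6; split.
- move=> alpha F w; apply: blin_ext => f; congr (F _); apply: blin_ext => a.
  by congr (w _); apply: blin_ext => x /=; rewrite h1.
- move=> F alpha w; apply: blin_ext => f; congr (F _); apply: blin_ext => a.
  by congr (w _); apply: blin_ext => x /=; rewrite h2.
- move=> alpha w F; apply: blin_ext => f; congr (w _); apply: blin_ext => x.
  by congr (F _); apply: blin_ext => a /=; rewrite h3.
- move=> w F alpha; apply: blin_ext => f; congr (w _); apply: blin_ext => x.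
  by congr (F _); apply: blin_ext => a /=; rewrite h4.
- move=> w alpha F; apply: blin_ext => f; congr (w _); apply: blin_ext => x.
  by congr (F _); apply: blin_ext => a /=; rewrite h5.
- move=> F w alpha; apply: blin_ext => f; congr (F _); apply: blin_ext => a.
  by congr (w _); apply: blin_ext => x /=; rewrite h6.
Qed.

End Compatibility.

(** * Complex linear module derivations *)

Section Derivations.
Context {R : realType} (U A : banachAlgebra R) (m : banachBimodule U A).

(** With W the third dual of X, the second adjoint of D is a derivation
A** -> W, made dual-valued by embedding W in W**. An element of W** implementing
it is then evaluated on X, embedded in its fourth dual W*. *)
Lemma linear_derivation_inner (X : completeNormedModType R[i])
    (XA : banachBimodule A X) (XU : banachBimodule U X) (D : 'L(A, dual X)) :
  module_amenable (second_dual_bimodule m) ->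
  compatible_bimodules m XA XU -> commutative_bimodule XU ->
  module_derivation m (dual_bimodule XA) (dual_bimodule XU) D ->
  inner_derivation (dual_bimodule XA) D.
Proof.
move=> amen cX comm [_ _ _ Dmul Dl Dr].
pose E := dual X; pose W := dual (dual E).
pose EA : banachBimodule A E := dual_bimodule XA.
pose EU : banachBimodule U E := dual_bimodule XU.
pose WA := bidual_bimodule EA.
pose WU := dual_bimodule (dual_bimodule EU).
pose D2 : 'L(second_dual A, W) := transpose (transpose D).
pose T := blin_comp (canon W) D2.
have D2mul F G : D2 (F ** G) = ract WA (D2 F) G + lact WA F (D2 G).
  apply: blin_ext => f; rewrite blin_addE.
  (* Evaluated at f, both sides are F (a |-> G (b |-> f (D (a ** b)))), with the
     Leibniz rule applied inside: g1 collects f (D a . b), g2 f (a . D b). *)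
  pose g1 : dual A := transpose D (adjoint (adjoint (ract_bilin EA)) G f).
  pose g2 : dual A := adjoint (adjoint (lact_bilin EA)) (D2 G) f.
  transitivity (F (g1 + g2)); last exact: blinD.
  congr (F _); apply: blin_ext => a; rewrite blin_addE.
  pose h1 : dual A := adjoint (ract_bilin EA) f (D a).
  pose h2 : dual A := transpose D (adjoint (lact_bilin EA) f a).
  transitivity (G (h1 + h2)); last exact: blinD.
  congr (G _); apply: blin_ext => b; rewrite blin_addE.
  transitivity (f (D (a ** b))) => //.
  by rewrite Dmul blinD.
have D2l alpha F : D2 (lact (second_dual_bimodule m) alpha F) =
    lact WU alpha (D2 F).
  apply: blin_ext => f; congr (F _); apply: blin_ext => a.
  by transitivity (f (D (lact m alpha a))) => //; rewrite Dl.
have D2r F alpha : D2 (ract (second_dual_bimodule m) F alpha) =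
    ract WU (D2 F) alpha.
  apply: blin_ext => f; congr (F _); apply: blin_ext => a.
  by transitivity (f (D (ract m a alpha))) => //; rewrite Dr.
have [] := amen (dual W) (dual_bimodule WA) (dual_bimodule WU) _ _ T.
- exact/dual_compatible/bidual_compatible/dual_compatible.
- exact/dual_commutative/dual_commutative/dual_commutative/dual_commutative.
- split.
  + have [K _ TK] := blin_rbounded T.
    by apply: (@mk_rbounded _ _ _ T); exists K.
  + exact: blinD.
  + exact: blinB.
  + move=> F G; apply: blin_ext => p.
    by transitivity (p (D2 (F ** G))) => //; rewrite D2mul blinD.
  + move=> alpha F; apply: blin_ext => p.
    by congr (p _); exact: D2l.
  + move=> F alpha; apply: blin_ext => p.
    by congr (p _); exact: D2r.
move=> xi xiP.
(* On the image of P the actions of A** restricted to A are those of X, and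
   T (canon A a) is the evaluation of D a. *)
pose P : 'L(X, dual W) := blin_comp (canon (dual E)) (canon X).
exists (transpose P xi) => a; apply: blin_ext => x.
have := congr1 (fun z : dual (dual W) => z (P x)) (xiP (canon A a)).
rewrite !blin_subE => e; transitivity (T (canon A a) (P x)) => //.
by rewrite e; congr (xi _ - xi _); apply: blin_ext => w; congr (w _);
  apply: blin_ext.
Qed.

End Derivations.

(** * Real linearity of bounded additive maps *)

Section RealLinearity.
Context {R : realType} (X Y : completeNormedModType R[i]) (D : X -> Y).
Hypothesis Dsub : forall x y, D (x - y) = D x - D y.
Hypothesis Dbnd : exists C : R, forall x, `|D x| <= C%:C * `|x|.

(** The defect d s = D (s x) - s D x is additive in s, is bounded for |s| <= 1
and vanishes at integers, so it is bounded on R; as n d t = d (n t), it is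
zero. *)
Lemma additive_bounded_rscale (t : R) x : D (t%:C *: x) = t%:C *: D x.
Proof.
have [C DC] := Dbnd.
have {}DC y : rnorm (D y) <= `|C| * rnorm y.
  have := DC y; rewrite normM_leE => /le_trans; apply.
  by rewrite ler_wpM2r ?rnorm_ge0 ?ler_norm.
pose d (s : R) : Y := D (s%:C *: x) - s%:C *: D x.
have dB : zmod_morphism d.
  move=> r s; rewrite /d rmorphB !scalerBl Dsub !opprB addrACA [RHS]addrACA.
  by congr (_ + _); rewrite addrC.
pose dA : {additive R -> Y} := HB.pack d (GRing.isZmodMorphism.Build R Y d dB).
have d1 : d 1 = 0 by rewrite /d rmorph1 !scale1r subrr.
pose K := `|C| * rnorm x + `|C| * rnorm x.
have dK s : `|s| <= 1 -> rnorm (d s) <= K.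
  move=> s1; rewrite (le_trans (rnormB _ _))// lerD//.
    rewrite (le_trans (DC _))// rnormZr ler_wpM2l// ler_piMl ?rnorm_ge0//.
  by rewrite rnormZr (le_trans _ (DC x))// ler_piMl ?rnorm_ge0.
have dn n : n%:R * rnorm (d t) <= K.
  have -> : n%:R * rnorm (d t) = rnorm (d (t *+ n)).
    rewrite -[d (t *+ n)]/(dA (t *+ n)) raddfMn.
    have -> : dA t *+ n = (n%:R : R)%:C *: d t by rewrite rmorph_nat scaler_nat.
    by rewrite rnormZr ger0_norm.
  have -> : d (t *+ n) = d (t *+ n - (Num.floor (t *+ n))%:~R).
    rewrite -[RHS]/(dA _) raddfB -[X in _ = _ - X]/(dA (1 *~ _)) raddfMz.
    by rewrite [dA 1]d1 mul0rz subr0.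
  apply: dK.
  have /andP[h1 h2] := real_floor_itv (num_real (t *+ n)).
  rewrite ger0_norm ?subr_ge0// lerBlDl -[X in _ + X]/(1%:~R) -intrD.
  exact: ltW.
apply/eqP; rewrite -subr_eq0 -/(d t); apply/eqP/rnorm0_eq0/eqP.
rewrite eq_le rnorm_ge0 andbT leNgt; apply/negP => d0.
have := dn (Num.truncn (K / rnorm (d t))).+1.
by rewrite -ler_pdivlMr// leNgt truncnS_gt.
Qed.


Lemma additive_bounded_scale (c : R[i]) x :
  D (c *: x) =
    (complex.Re c)%:C *: D x + (complex.Im c)%:C *: D ('i%C *: x).
Proof.
have D0 : D 0 = 0 by rewrite -(subrr 0) Dsub subrr.
have DD y z : D (y + z) = D y + D z.
  by rewrite -[in LHS](opprK z) -(sub0r z) !Dsub D0 sub0r opprK.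
rewrite -!additive_bounded_rscale -DD scalerA -scalerDl.
congr (D (_ *: _)); case: c => a b.
by rewrite [LHS]complexE/= mulrC.
Qed.

End RealLinearity.

(** * Conjugate linear derivations *)

Section ZeroBimodule.
Context {R : realType} (B : banachAlgebra R) (X : completeNormedModType R[i]).

Let zero_linear (V : completeNormedModType R[i]) : linear (fun _ : V => 0 : X).
Proof. by move=> c x y; rewrite scaler0 addr0. Qed.

Let zero_bound (V W : completeNormedModType R[i]) : exists K : R,
  forall (v : V) (w : W), `|0 : X| <= K%:C * (`|v| * `|w|).
Proof. by exists 0 => v w; rewrite normr0 mul0r. Qed.

Definition zero_bimodule : banachBimodule B X :=
  @BanachBimodule R B X (fun _ _ => 0) (fun _ _ => 0)
    (fun _ => @zero_linear B) (fun _ => @zero_linear X)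
    (fun _ => @zero_linear X) (fun _ => @zero_linear B)
    (fun _ _ _ => erefl) (fun _ _ _ => erefl) (fun _ _ _ => erefl)
    (zero_bound B X) (zero_bound X B).

End ZeroBimodule.

Section Conjugate.
Context {R : realType}.

Definition conj_scalar (z : scalars R) : scalars R := (z : R[i])^*%C.

Lemma conj_scalar_lin (c : R[i]) (y z : scalars R) :
  conj_scalar (c *: y + z) = c^*%C *: conj_scalar y + conj_scalar z.
Proof.
transitivity (((c * (y : R[i]) + (z : R[i])) : R[i])^*%C) => //.
by rewrite rmorphD rmorphM.
Qed.

Lemma conj_scalar_norm z : rnorm (conj_scalar z) = rnorm z.
Proof. by rewrite /rnorm /conj_scalar; congr complex.Re; exact: normcJ. Qed.

Lemma conj_scalarK : involutive conj_scalar.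
Proof. exact: conjcK. Qed.

(** A conjugate linear map has no adjoint among C-linear functionals; one
conjugation makes v |-> D v x linear, and a second one restores linearity in
x. *)
Section ConjLift.
Variables (V X : completeNormedModType R[i]) (D : V -> dual X) (C : R).
Hypothesis DB : forall v, rnorm (D v) <= C * rnorm v.
Hypothesis Dlin : forall (c : R[i]) v w, D (c *: v + w) = c^*%C *: D v + D w.

Lemma conj_coef_linear x : linear (fun v => conj_scalar (D v x)).
Proof.
by move=> c v w; rewrite Dlin blin_addE blin_scaleE conj_scalar_lin conjcK.
Qed.

Lemma conj_coef_norm x v : rnorm (conj_scalar (D v x)) <= C * rnorm x * rnorm v.
Proof.
rewrite conj_scalar_norm (le_trans (blin_normP _ _))//.
by rewrite mulrAC ler_wpM2r ?rnorm_ge0.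
Qed.

Definition conj_coef x : dual V :=
  mk_blin (conj_coef_linear x) (ex_intro _ _ (conj_coef_norm x)).

Lemma conj_coef_lin (c : R[i]) x y :
  conj_coef (c *: x + y) = c^*%C *: conj_coef x + conj_coef y.
Proof.
apply: blin_ext => v; rewrite blin_addE blin_scaleE /=.
by rewrite blinD blinZ conj_scalar_lin.
Qed.

Lemma conj_lift_linear (F : dual (dual V)) :
  linear (fun x => conj_scalar (F (conj_coef x))).
Proof.
by move=> c x y; rewrite conj_coef_lin blinD blinZ conj_scalar_lin conjcK.
Qed.

Lemma conj_lift_norm (F : dual (dual V)) x :
  rnorm (conj_scalar (F (conj_coef x))) <= `|C| * rnorm F * rnorm x.
Proof.
rewrite conj_scalar_norm (le_trans (blin_normP _ _))//.
rewrite (mulrC `|C|) -mulrA ler_wpM2l ?rnorm_ge0//.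
apply: blin_norm_le => [|v]; first by rewrite mulr_ge0 ?rnorm_ge0.
rewrite (le_trans (conj_coef_norm _ _))// ler_wpM2r ?rnorm_ge0//.
by rewrite ler_wpM2r ?rnorm_ge0 ?ler_norm.
Qed.

Definition conj_lift (F : dual (dual V)) : dual X :=
  mk_blin (conj_lift_linear F) (ex_intro _ _ (conj_lift_norm F)).

Lemma conj_lift_rnorm F : rnorm (conj_lift F) <= `|C| * rnorm F.
Proof.
apply: blin_norm_le => [|x]; first by rewrite mulr_ge0 ?rnorm_ge0.
exact: conj_lift_norm.
Qed.

Lemma conj_liftB F G : conj_lift (F - G) = conj_lift F - conj_lift G.
Proof.
apply: blin_ext => x; rewrite blin_subE.
transitivity (conj_scalar (F (conj_coef x) - G (conj_coef x))).
  by congr conj_scalar; exact: blin_subE.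
exact: (rmorphB (@conjc R)).
Qed.

Lemma conj_lift_canon v : conj_lift (canon V v) = D v.
Proof. by apply: blin_ext => x; exact: conj_scalarK. Qed.

End ConjLift.
End Conjugate.

Section ConjugateDerivation.
Context {R : realType} (U A : banachAlgebra R) (m : banachBimodule U A).
Variables (X : completeNormedModType R[i]) (XU : banachBimodule U X).

(** The extension of D to A** is a derivation for the zero action of A** on X,
for which the only inner derivation is zero. *)
Lemma conj_derivation_eq0 (D : A -> dual X) :
  module_amenable (second_dual_bimodule m) -> commutative_bimodule XU ->
  (exists C : R, forall a, rnorm (D a) <= C * rnorm a) ->
  (forall (c : R[i]) a b, D (c *: a + b) = c^*%C *: D a + D b) ->
  (forall a b, D (a ** b) = 0) ->
  (forall alpha a, D (lact m alpha a) = lact (dual_bimodule XU) alpha (D a)) ->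
  (forall a alpha, D (ract m a alpha) = ract (dual_bimodule XU) (D a) alpha) ->
  forall a, D a = 0.
Proof.
move=> amen comm [C DC] Dlin Dmul Dl Dr a.
pose T : second_dual A -> dual X := conj_lift DC Dlin.
have [] := amen X (zero_bimodule (second_dual A) X) XU _ comm T.
- split=> //= *.
  + exact: (linear_map0 (lact_linearr XU _)).
  + exact/esym/(linear_map0 (lact_linearr XU _)).
  + exact: (linear_map0 (ract_linearl XU _)).
  + exact/esym/(linear_map0 (ract_linearl XU _)).
- have TB F G : T (F - G) = T F - T G by exact: conj_liftB.
  split.
  + apply: mk_rbounded; exists `|C| => F; exact: conj_lift_rnorm.
  + move=> F G; rewrite -[in LHS](opprK G) -(sub0r G) !TB -{1}(subrr 0) TB.
    by rewrite subrr sub0r opprK.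
  + exact: TB.
  + move=> F G; apply: blin_ext => x.
    transitivity (conj_scalar (F 0)); last first.
      rewrite blin0 blin_addE; transitivity (0 + 0 : scalars R).
        by rewrite addr0; exact: conjc0.
      by congr (_ + _); apply/esym; exact: blin0.
    congr (conj_scalar (F _)); apply: blin_ext => b.
    transitivity (G 0); last exact: blin0.
    congr (G _); apply: blin_ext => c.
    transitivity (conj_scalar (D (b ** c) x)) => //.
    by rewrite Dmul; exact: conjc0.
  + move=> alpha F; apply: blin_ext => x; congr (conj_scalar (F _)).
    by apply: blin_ext => b; congr conj_scalar; rewrite Dl.
  + move=> F alpha; apply: blin_ext => x; congr (conj_scalar (F _)).
    by apply: blin_ext => b; congr conj_scalar; rewrite Dr.
move=> xi xiP; rewrite -(conj_lift_canon DC Dlin) -/T.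
by apply: blin_ext => x; rewrite xiP blin_subE /= blin0 subrr.
Qed.

End ConjugateDerivation.

(** * Module derivations are complex linear *)

Section ScaleByI.
Context {R : realType} (U A : banachAlgebra R) (m : banachBimodule U A).
Variables (X : completeNormedModType R[i]).
Variables (XA : banachBimodule A X) (XU : banachBimodule U X).

(** The map E below is conjugate linear, so E = 0 says exactly that D commutes
with i. On products, E ((i a) b) is i E (a b) by the Leibniz rule and - i E (a b)
by conjugate linearity. *)
Lemma module_derivation_scale_i (D : A -> dual X) :
  module_amenable (second_dual_bimodule m) -> commutative_bimodule XU ->
  module_derivation m (dual_bimodule XA) (dual_bimodule XU) D ->
  forall a, D ('i%C *: a) = 'i%C *: D a.
Proof.
move=> amen comm [[C DC] DD DB Dmul Dl Dr].
pose XA' := dual_bimodule XA; pose XU' := dual_bimodule XU.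
pose E a := D a + 'i%C *: D ('i%C *: a) : dual X.
have ii : 'i%C * 'i%C = -1 :> R[i] by exact: sqr_i.
have DZ := additive_bounded_scale DB (ex_intro _ C DC).
have EB : exists C : R, forall a, rnorm (E a) <= C * rnorm a.
  exists (C + C) => a; rewrite mulrDl (le_trans (rnormD _ _))// lerD//.
    by rewrite -normM_leE.
  have ni : complex.Re `|'i%C : R[i]| = 1.
    by rewrite normc_def/= expr0n expr1n add0r sqrtr1.
  have := DC ('i%C *: a); rewrite normM_leE !rnormZ ni !mul1r; exact.
have ED a b : E (a + b) = E a + E b.
  by rewrite /E scalerDr !DD scalerDr addrACA.
have EZ (c : R[i]) a : E (c *: a) = c^*%C *: E a.
  rewrite /E scalerA (DZ c) (DZ ('i%C * c)) !scalerDr !scalerA addrACA.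
  rewrite -!scalerDl; congr (_ *: _ + _ *: _); case: c => p q;
  by apply/eqP; rewrite eq_complex/=; apply/andP; split; apply/eqP; ring.
have Elin (c : R[i]) a b : E (c *: a + b) = c^*%C *: E a + E b.
  by rewrite ED EZ.
have Emulr a b : E (a ** b) = lact XA' a (E b).
  rewrite /E -(linear_mapZ (ba_mul_linearr a)) !Dmul.
  rewrite (linear_mapZ (ract_linearr XA' _)) -/XA' scalerDr scalerA ii.
  rewrite scaleN1r addrACA subrr add0r.
  by rewrite -(linear_mapZ (lact_linearr XA' _))
    -(linear_mapD (lact_linearr XA' _)).
have Emul a b : E (a ** b) = 0.
  have e1 : E (('i%C *: a) ** b) = 'i%C *: E (a ** b).
    by rewrite !Emulr (linear_mapZ (lact_linearl XA' _)).
  have e2 : E (('i%C *: a) ** b) = - ('i%C *: E (a ** b)).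
    rewrite (linear_mapZ (ba_mul_linearl b)) EZ -scaleNr; congr (_ *: _).
    by apply/eqP; rewrite eq_complex/= oppr0 !eqxx.
  have : ('i%C + 'i%C : R[i]) *: E (a ** b) = 0.
    by rewrite scalerDl -{1}e1 e2 addNr.
  move/eqP; rewrite scaler_eq0 => /orP[|/eqP//].
  by rewrite -mulr2n mulrn_eq0 /= eq_complex/= oner_eq0 andbF.
have El alpha a : E (lact m alpha a) = lact XU' alpha (E a).
  rewrite /E -(linear_mapZ (lact_linearr m _)) !Dl -/XU'.
  by rewrite -(linear_mapZ (lact_linearr XU' _))
    -(linear_mapD (lact_linearr XU' _)).
have Er a alpha : E (ract m a alpha) = ract XU' (E a) alpha.
  rewrite /E -(linear_mapZ (ract_linearl m _)) !Dr -/XU'.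
  by rewrite -(linear_mapZ (ract_linearl XU' _))
    -(linear_mapD (ract_linearl XU' _)).
move=> a; have E0 : E a = 0.
  exact: (conj_derivation_eq0 amen comm EB Elin Emul El Er).
have : 'i%C *: E a = 0 by rewrite E0 scaler0.
by rewrite /E scalerDr scalerA ii scaleN1r => /eqP; rewrite subr_eq0 => /eqP.
Qed.

End ScaleByI.

Theorem theorem3p4 (R : realType) (U A : banachAlgebra R)
    (m : banachBimodule U A)
    (m_compatible : compatible_actions m)
    (quotient_A : commutative_quotient m (module_ideal m))
    (quotient_Add : commutative_quotient (second_dual_bimodule m)
      (module_ideal (second_dual_bimodule m))) :
  module_amenable (second_dual_bimodule m) -> module_amenable m.
Proof.
move=> amen X XA XU cX comm D derD.
have Di := module_derivation_scale_i amen comm derD.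
have [[C DC] DD DB _ _ _] := derD.
have DZ := additive_bounded_scale DB (ex_intro _ C DC).
have Dlin : linear D.
  move=> c a b; rewrite DD DZ Di scalerA -scalerDl; congr (_ *: _ + _).
  by rewrite [RHS]complexE/= mulrC.
have Dbd : exists M : R, forall a, rnorm (D a) <= M * rnorm a.
  by exists C => a; rewrite -normM_leE.
exact: (linear_derivation_inner (D := mk_blin Dlin Dbd) amen cX comm).
Qed.
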